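(* Let $G$ be a connected $r$-regular graph with $r\geq 2$, of order $n$ with $m$ edges, and let $\lambda_0>\lambda_1>\cdots>\lambda_d$ be the distinct eigenvalues of $A(G)$. Let $u,v$ be vertices of $G$, let $S=\mathrm{supp}_{A(G)}(u)$, and suppose that there is a square-free integer $\Delta$ (with $\Delta=1$ allowed when all elements of $S$ are integers) such that each $\lambda\in S$ has the form $\lambda=\frac{1}{2}(a+b_\lambda\sqrt{\Delta})$ with integers $a,b_\lambda$; let $$g=\gcd\left\{\frac{\lambda_0-\lambda}{\sqrt{\Delta}}:\lambda\in S\right\}.$$ Assume that $G$ has perfect state transfer between $u$ and $v$ at time $t=\pi/g$. Then: (i) if $G$ is non-bipartite, $\mathcal{Q}(G)$ has pretty good state transfer between $u$ and $v$; (ii) if $G$ is bipartite and $r/g$ is an even integer, $\mathcal{Q}(G)$ has pretty good state transfer between $u$ and $v$.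
   Context: All graphs are finite, simple, undirected. For an eigenvalue $\lambda$ of $A(G)$, $E_\lambda$ denotes the orthogonal projection onto its eigenspace (so $E_\lambda=\sum_j x_jx_j^T$ for an orthonormal basis $\{x_j\}$ of the eigenspace). The eigenvalue support $\mathrm{supp}_{A(G)}(u)$ is the set of eigenvalues $\lambda$ of $A(G)$ with $E_\lambda e_u\neq 0$, where $e_u$ is the characteristic vector of $u$. The $\mathcal{Q}$-graph $\mathcal{Q}(G)$ has vertex set $V(G)\cup N(G)$, where $N(G)$ contains one new vertex for each edge of $G$; each new vertex is adjacent to the two endpoints of its edge, two new vertices are adjacent iff their edges share an endpoint in $G$, and vertices of $V(G)$ are pairwise non-adjacent in $\mathcal{Q}(G)$. A graph $H$ has perfect state transfer between distinct vertices $x,y$ at time $t$ if $\exp(-itA(H))e_x=\gamma e_y$ with $|\gamma|=1$; it has pretty good state transfer between $x$ and $y$ if for every $\epsilon>0$ there is $t\in\mathbb{R}$ with $|\exp(-itA(H))_{xy}|>1-\epsilon$. *)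

(* Defs.v *)
From HB Require Import structures.
From mathcomp Require Import all_boot all_order all_algebra.
From mathcomp Require Import complex.
From mathcomp Require Import all_classical all_reals all_analysis.

Set Implicit Arguments.
Unset Strict Implicit.
Unset Printing Implicit Defensive.

Import Order.TTheory GRing.Theory Num.Theory.
Import numFieldTopology.Exports numFieldNormedType.Exports.

Local Open Scope ring_scope.

Record sgraph := SGraph {
  vertex :> finType;
  adj : rel vertex;
  adj_sym : symmetric adj;
  adj_irrefl : irreflexive adj
}.

Definition regular (G : sgraph) (r : nat) : Prop :=
  forall x : G, #|[pred y | adj x y]| = r.

Definition connected_graph (G : sgraph) : Prop :=
  (0 < #|G|)%N /\ forall x y : G, connect (@adj G) x y.

Definition bipartite (G : sgraph) : Prop :=
  exists c : G -> bool, forall x y : G, adj x y -> c x != c y.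

Definition is_edge (G : sgraph) (E : {set G}) : bool :=
  [exists x : G, exists y : G, adj x y && (E == [set x; y]%SET)].

Definition edge (G : sgraph) := {E : {set G} | is_edge E}.

Section QGraph.
Variable G : sgraph.

Definition Qvertex : finType := (G + edge G)%type.

Definition Qadj : rel Qvertex := fun p q =>
  match p, q with
  | inl _, inl _ => false
  | inl x, inr E => x \in val E
  | inr E, inl x => x \in val E
  | inr E, inr F => (E != F) && (val E :&: val F != finset.set0)%SET
  end.

Lemma Qadj_sym : symmetric Qadj.
Proof. by move=> [x|E] [y|F] //=; rewrite eq_sym finset.setIC. Qed.

Lemma Qadj_irrefl : irreflexive Qadj.
Proof. by move=> [x|E] //=; rewrite eqxx. Qed.

Definition Qgraph : sgraph := SGraph Qadj_sym Qadj_irrefl.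

End QGraph.

(* Rows and columns follow the enumeration of the vertices given by
   [enum_rank] and [enum_val]. *)
Definition adjmx (K : pzRingType) (G : sgraph) : 'M[K]_#|G| :=
  \matrix_(i, j) (adj (enum_val i) (enum_val j))%:R.

Definition charvec (K : pzRingType) (G : sgraph) (x : G) : 'cV[K]_#|G| :=
  delta_mx (enum_rank x) 0.

(* Orthogonal projection onto the row space of [U] along its orthogonal
   complement [kermx U^T]. As all of MathComp's row-space theory it acts on row
   vectors; over a real field the matrix is symmetric, so it also projects
   column vectors. *)
Definition orthproj (F : fieldType) (m n : nat) (U : 'M[F]_(m, n)) : 'M[F]_n :=
  proj_mx <<U>>%MS (kermx U^T).

Definition eigenproj (R : realType) (G : sgraph) (lam : R) : 'M[R]_#|G| :=
  orthproj (eigenspace (adjmx R G) lam).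

Definition eigensupp (R : realType) (G : sgraph) (u : G) (lam : R) : Prop :=
  eigenvalue (adjmx R G) lam /\ eigenproj G lam *m charvec R u != 0.

Definition mexp (K : numFieldType) (n : nat) (M : 'M[K]_n) : 'M[K]_n :=
  limn (series (fun k => (k`!%:R)^-1 *: M ^+ k)).

Definition transition (R : realType) (H : sgraph) (t : R) : 'M[R[i]]_#|H| :=
  mexp (- ('i * t%:C)%C *: adjmx R[i] H).

Definition PST (R : realType) (H : sgraph) (x y : H) (t : R) : Prop :=
  x != y /\ exists2 gam : R[i], `|gam| = 1 &
    transition H t *m charvec R[i] x = gam *: charvec R[i] y.

Definition PGST (R : realType) (H : sgraph) (x y : H) : Prop :=
  x != y /\ forall eps : R, 0 < eps -> exists t : R,
    (1 - eps)%:C%C < `|transition H t (enum_rank x) (enum_rank y)|.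

Definition squarefree (D : int) : Prop :=
  forall d : int, (d ^+ 2 %| D)%Z -> `|d| = 1.

(* [g] is the greatest common divisor of a set of reals, all of which are
   integers. *)
Definition is_gcd (R : realType) (X : R -> Prop) (g : nat) : Prop :=
  let divides (d : nat) :=
    forall x, X x -> exists k : int, x = (k * d%:Z)%:~R in
  divides g /\ forall d : nat, divides d -> (d %| g)%N.

(* Main.v *)
(* Write mu = lam + r for an eigenvalue lam of G. On the span of (x, 0) and
   (0, N^T x), for an eigenvector x of lam and the incidence matrix N, the graph
   Q(G) acts with eigenvalues (mu - 2 +- sqrt (mu ^ 2 + 4)) / 2, so its
   (u, v)-amplitude is a weighted mean over the support of u of the corresponding
   exponentials. Perfect state transfer at pi / g already forces
   lam = r - g l with l an integer, whose parity is the sign relating the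
   projections of u and v. As mu is an integer, sqrt (mu ^ 2 + 4) = s sqrt D with
   D square-free, and D > 1 unless mu = 0. By Kronecker's theorem and the linear
   independence of the sqrt D over Q, the phases expi (t sqrt D / 2) can be
   prescribed for t in 4 pi Z + t0. When G is bipartite and g is even, the phase
   prescribed to D has to be compatible with the parities of all l that share this
   D, which follows from the structure of the solutions of x ^ 2 + 1 = D s ^ 2. *)
Require Import Defs.
From mathcomp Require Import all_boot all_order all_algebra.
From mathcomp Require Import complex.
From mathcomp Require Import all_classical all_reals all_analysis.
From mathcomp Require Import ring lra zify.

Set Implicit Arguments.
Unset Strict Implicit.
Unset Printing Implicit Defensive.

Import Order.TTheory GRing.Theory Num.Theory.
Import numFieldTopology.Exports numFieldNormedType.Exports.
Local Open Scope ring_scope.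

(** * The exponential *)

Section Expi.
Variable R : realType.
Implicit Types x y : R.
Local Notation C := (R[i] : numFieldType).

Definition expi x : R[i] := (cos x +i* sin x)%C.

Lemma expi0 : expi 0 = 1.
Proof. by rewrite /expi cos0 sin0. Qed.

Lemma expiD x y : expi (x + y) = expi x * expi y.
Proof.
rewrite /expi cosD sinD; apply/eqP; rewrite eq_complex /=.
by apply/andP; split; apply/eqP; ring.
Qed.

Lemma expiN x : expi (- x) = (expi x)^*%C.
Proof. by rewrite /expi cosN sinN. Qed.

Lemma norm_expi x : `|expi x| = 1.
Proof. by rewrite normc_def /= cos2Dsin2 sqrtr1. Qed.

Lemma expi_neq0 x : expi x != 0.
Proof. by rewrite -normr_eq0 norm_expi oner_eq0. Qed.

Lemma expiNV x : expi (- x) = (expi x)^-1.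
Proof. by apply: (mulfI (expi_neq0 x)); rewrite -expiD subrr expi0 mulfV ?expi_neq0. Qed.

Lemma expiX x n : expi x ^+ n = expi (x * n%:R).
Proof.
elim: n => [|n IHn]; first by rewrite mulr0 expi0.
by rewrite exprS IHn -expiD mulrSr mulrDr mulr1 addrC.
Qed.

Lemma expiXz x (k : int) : expi x ^ k = expi (x * k%:~R).
Proof.
case: k => n; first by rewrite -exprnP expiX.
by rewrite NegzE -exprnN expiX -expiNV mulrNz mulrN.
Qed.

Lemma expi_pi : expi pi = -1.
Proof. by rewrite /expi cospi sinpi; apply/eqP; rewrite eq_complex /= oppr0 !eqxx. Qed.

Lemma expi_2pi (k : int) : expi (2 * pi * k%:~R) = 1.
Proof.
by rewrite -expiXz mulr_natl mulr2n expiD expi_pi mulrNN mulr1 exp1rz.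
Qed.

Lemma expi_eq1 x : expi x = 1 -> exists k : int, x = 2 * pi * k%:~R.
Proof.
move=> x1; pose k := Num.floor (x / (2 * pi)); exists k.
have pi2 : 0 < 2 * pi :> R by rewrite mulr_gt0 ?pi_gt0.
pose y := x - 2 * pi * k%:~R.
have y1 : expi y = 1.
  by rewrite /y -mulrN -mulrNz expiD expi_2pi mulr1.
have /andP[y0 y2] : 0 <= y < 2 * pi.
  have /andP[h1 h2] := floor_itv (x / (2 * pi)).
  rewrite -/k in h1 h2; rewrite /y subr_ge0 -ler_pdivlMl // [_^-1 * _]mulrC h1 /=.
  by rewrite ltrBlDl -{2}[2 * pi]mulr1 -mulrDr -ltr_pdivrMl // [_^-1 * _]mulrC; move: h2; rewrite intrD.
have cos1 : forall z : R, 0 <= z <= pi -> cos z = 1 -> z = 0.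
  by move=> z hz cz; apply: (@cos_inj R z 0); rewrite ?in_itv /= ?cos0 ?lexx ?pi_ge0.
have yc : cos y = 1 by move: y1 => /(congr1 (fun z => complex.Re z)).
suff y00 : y = 0 by apply/eqP; rewrite -subr_eq0 -/y y00.
have [yp|yp] := leP y pi; first by apply: cos1; rewrite ?y0.
suff : 2 * pi - y = 0 by move: y2 => /[swap]; lra.
apply: cos1; first by apply/andP; split; lra.
have : expi (2 * pi * 1%:~R - y) = 1 by rewrite expiD expi_2pi expiNV y1 invr1 mulr1.
by move=> /(congr1 (fun z => complex.Re z)); rewrite /= mulr1.
Qed.

Lemma expi_sqr1 x : expi x * expi x = 1 -> exists k : int, x = pi * k%:~R.
Proof.
rewrite -expiD => /expi_eq1[k xk]; exists k.
by move: xk; lra.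
Qed.

Lemma expi_term y k :
  (k`!%:R)^-1 * (- ('i * y%:C)%C) ^+ k =
  (cos_coeff y k +i* - sin_coeff y k)%C :> R[i].
Proof.
have i2 : ('i%C * 'i%C = -1 :> R[i]) by rewrite -expr2 sqr_i.
have -> : (- ('i * y%:C)%C) = (-'i%C) * y%:C%C :> R[i] by rewrite mulNr.
have -> : (k`!%:R)^-1 = ((k`!%:R : R)^-1)%:C%C :> R[i] by rewrite fmorphV rmorph_nat.
rewrite exprMn -rmorphXn /=.
have ipow : (-'i%C) ^+ k =
    ((~~ odd k)%:R * (-1) ^+ k./2 +i* - ((odd k)%:R * (-1) ^+ k.-1./2))%C :> R[i].
  have pow2 : forall j, (- 'i%C) ^+ j.*2 = ((-1) ^+ j)%:C%C :> R[i].
    by move=> j; rewrite -mul2n exprM sqrrN expr2 i2 rmorphXn rmorphN1.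
  rewrite -{1}(odd_double_half k); case: (boolP (odd k)) => ok.
    rewrite add1n exprS pow2 /= mul0r mul1r.
    have -> : k.-1./2 = k./2 by move: (odd_double_half k); rewrite ok /=; lia.
    by apply/eqP; rewrite eq_complex /=; apply/andP; split; apply/eqP; ring.
  rewrite add0n pow2 /=; apply/eqP; rewrite eq_complex /=.
  by apply/andP; split; apply/eqP; ring.
rewrite ipow /cos_coeff /sin_coeff /= -!exprnP.
by apply/eqP; rewrite eq_complex /=; apply/andP; split; apply/eqP; ring.
Qed.

Lemma cvg_complex (f g : R ^nat) (a b : R) :
  (f @ \oo --> a -> g @ \oo --> b ->
  (fun k => (f k +i* g k)%C : C) @ \oo --> ((a +i* b)%C : C))%classic.
Proof.
move=> fa gb; apply/cvgrPdist_lt => e e0.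
have [e1 e2] : complex.Im e = 0 /\ 0 < complex.Re e.
  by move: e0; rewrite ltcE /= => /andP[/eqP -> ->].
have eE : e = (complex.Re e)%:C%C.
  by apply/eqP; rewrite eq_complex /= e1 !eqxx.
have h : 0 < complex.Re e / 2 by rewrite divr_gt0.
move/cvgrPdist_lt : fa => /(_ _ h) fa.
move/cvgrPdist_lt : gb => /(_ _ h) gb.
near=> k.
have -> : (a +i* b)%C - (f k +i* g k)%C = (a - f k)%:C%C + 'i%C * (b - g k)%:C%C :> R[i].
  by apply/eqP; rewrite eq_complex /=; apply/andP; split; apply/eqP; ring.
apply: le_lt_trans (ler_normD _ _) _.
have normi : `|'i%C| = 1 :> R[i] by rewrite normc_def /= expr0n expr1n add0r sqrtr1.
rewrite normrM normi mul1r.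
have normC : forall x : R, `|x%:C%C| = (`|x|)%:C%C :> R[i].
  by move=> x; rewrite normc_def /= expr0n addr0 sqrtr_sqr.
rewrite !normC -rmorphD /= eE ltcR [ltRHS]splitr ltrD //; near: k; [exact: fa|exact: gb].
Unshelve. all: by end_near. Qed.

Lemma cvg_expi y :
  (series (fun k => (k`!%:R)^-1 * (- ('i * y%:C)%C) ^+ k : C) @ \oo --> (expi (- y) : C))%classic.
Proof.
have -> : series (fun k => (k`!%:R)^-1 * (- ('i * y%:C)%C) ^+ k : C) =
  (fun k => (series (cos_coeff y) k +i* - series (sin_coeff y) k)%C).
  apply/funext => k; rewrite /series /=.
  rewrite (eq_bigr _ (fun i _ => expi_term y i)).
  elim: k => [|k IHk]; first by rewrite !big_geq // oppr0.
  rewrite !big_nat_recr //= IHk; apply/eqP; rewrite eq_complex /=.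
  by rewrite opprD !eqxx.
rewrite /expi cosN sinN; apply: cvg_complex.
  by rewrite unlock; exact: is_cvg_series_cos_coeff.
apply: cvgN; rewrite unlock; exact: is_cvg_series_sin_coeff.
Qed.
End Expi.

(** Neighbourhoods of a matrix are products of neighbourhoods of its entries, so finitely many
    entrywise limits can be controlled at once. *)
Lemma mexp_entries (K : numFieldType) n (M L : 'M[K]_n) :
  (forall i j, (series (fun k => (k`!%:R)^-1 * (M ^+ k) i j) @ \oo --> L i j)%classic) ->
  mexp M = L.
Proof.
move=> h; apply: cvg_lim; first exact: norm_hausdorff.
move=> A [P LP sPA]; rewrite /nbhs /=.
have : (\forall k \near \oo, forall i j,
    P i j (series (fun k => (k`!%:R)^-1 * (M ^+ k) i j) k))%classic.
  apply: filter_forall => i; apply: filter_forall => j; exact: h (LP i j).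
apply: filterS => k hk; apply: sPA => i j.
suff -> : (series (fun k => (k`!%:R)^-1 *: M ^+ k) k) i j =
    series (fun k => (k`!%:R)^-1 * (M ^+ k) i j) k by exact: hk.
by rewrite /series /= summxE; apply: eq_bigr => l _; rewrite mxE.
Qed.

(** * Kronecker's theorem *)

Section Kronecker.
Variable R : realType.
Local Notation C := R[i].

Lemma complex_bound (x : C) : 0 <= x -> exists n : nat, x <= n%:R.
Proof.
case: x => a b; rewrite lecE /= => /andP[/eqP b0 a0].
exists (Num.bound a); rewrite lecE /= raddfMn /= b0 mul0rn eqxx /=.
have := archi_boundP a0; move=> /ltW; congr (_ <= _).
by rewrite raddfMn.
Qed.

Lemma geometric_bounded (z : C) : `|z| = 1 -> z != 1 ->
  exists B : nat, forall K, `|\sum_(k < K) z ^+ k| <= B%:R.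
Proof.
move=> z1 zn1.
have zn0 : z - 1 != 0 by rewrite subr_eq0.
have [|B hB] := @complex_bound (2 / `|z - 1|); first by rewrite divr_ge0.
exists B => K; apply: le_trans hB.
rewrite ler_pdivlMr ?normr_gt0 // -normrM mulrC -subrX1.
by rewrite (le_trans (ler_normB _ _)) // normrX z1 expr1n normr1.
Qed.

(** Expanding the square, the diagonal terms give exactly the subtracted quantity; each off-diagonal
    term is a geometric sum of ratio [z p] different from 1, bounded independently of [K]. *)
Lemma mean_square (F : finType) (A : pred F) (c chi : F -> C) :
  (forall f, `|chi f| = 1) -> {in A &, injective chi} ->
  exists B : nat, forall K,
    `|\sum_(k < K) `|\sum_(f | A f) c f * chi f ^+ k| ^+ 2
      - K%:R * \sum_(f | A f) `|c f| ^+ 2| <= B%:R.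
Proof.
move=> chi1 chi_inj.
pose z (p : F * F) := chi p.1 * (chi p.2)^*%C.
pose T := [pred p : F * F | [&& A p.1, A p.2 & p.1 != p.2]].
have bnd p : exists B : nat, T p -> forall K, `|\sum_(k < K) z p ^+ k| <= B%:R.
  case: (boolP (T p)) => [/and3P[A1 A2 p12]|]; last by exists 0%N.
  have [||B hB] := @geometric_bounded (z p); last by exists B.
    by rewrite /z normrM norm_conjC !chi1 mulr1.
  apply: contra p12 => /eqP zp; apply/eqP/chi_inj => //.
  have c2 : chi p.2 * (chi p.2)^*%C = 1 by rewrite -normCK chi1 expr1n.
  by rewrite -[LHS]mulr1 -c2 mulrCA [_ * _^*%C]zp mulr1.
have [B hB] := choice bnd.
have [|N hN] := @complex_bound (\sum_(p | T p) `|c p.1| * `|c p.2| * (B p)%:R).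
  by apply: sumr_ge0 => p _; rewrite !mulr_ge0.
exists N => K; apply: le_trans hN.
have sqE k : `|\sum_(f | A f) c f * chi f ^+ k| ^+ 2 =
    \sum_(f | A f) `|c f| ^+ 2 +
    \sum_(p | T p) c p.1 * (c p.2)^*%C * z p ^+ k.
  rewrite normCK rmorph_sum big_distrlr /= pair_big /=.
  rewrite (bigID (fun p : F * F => p.1 == p.2)) /=; congr (_ + _).
    rewrite (reindex_onto (fun f => (f, f)) (fun p : F * F => p.1)) /=; last first.
      by move=> [f f'] /= /andP[_ /eqP ->].
    apply: eq_big => [f|f _]; first by rewrite andbb !eqxx !andbT.
    by rewrite -normCK normrM normrX chi1 expr1n mulr1.
  apply: eq_big => [p|p _]; first by rewrite andbA.
  by rewrite rmorphM rmorphXn /= /z exprMn mulrACA.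
rewrite (eq_bigr _ (fun (k : 'I_K) _ => sqE k)) big_split /= sumr_const card_ord.
rewrite mulr_natl addrAC subrr add0r exchange_big /=.
apply: le_trans (ler_norm_sum _ _ _) _; apply: ler_sum => p Tp.
rewrite -mulr_sumr !normrM norm_conjC ler_wpM2l ?mulr_ge0 //.
exact: hB.
Qed.

Variables (I : finType) (w b : I -> C).
Hypothesis w1 : forall i, `|w i| = 1.
Hypothesis b1 : forall i, `|b i| = 1.
Hypothesis w_indep :
  forall m : I -> int, \prod_i w i ^ m i = 1 -> forall i, m i = 0.

(** The exponent vectors met when expanding the product over [J] of the sums of [z i ^ a], [a <= M];
    coordinates outside [J] are pinned to 0. *)
Let box M (J : pred I) : pred {ffun I -> 'I_M.+1} :=
  family (fun i => [pred a : 'I_M.+1 | J i || (a == ord0)]).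

Lemma card_box M (J : pred I) : #|@box M J| = (M.+1 ^ #|J|)%N.
Proof.
rewrite card_family foldrE big_map big_enum /=.
rewrite (bigID J) /= [X in (_ * X)%N]big1 ?muln1; last first.
  move=> i /negbTE Ji; rewrite -(card1 (ord0 : 'I_M.+1)); apply: eq_card => a.
  by rewrite !inE Ji.
rewrite -prod_nat_const; apply: eq_bigr => i Ji; rewrite -[RHS]card_ord; apply: eq_card => a.
by rewrite !inE [J i]Ji.
Qed.

Let z i k := w i ^+ k * (b i)^-1.

(** The product expands into terms with coefficients of modulus 1, whose characters are distinct by
    [w_indep]; the mean square is then the number of terms. *)
Lemma mean_box M (J : pred I) : exists B : nat, forall K,
  `|\sum_(k < K) `|\prod_(i | J i) \sum_(a < M.+1) z i k ^+ a| ^+ 2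
     - K%:R * (M.+1 ^ #|J|)%:R| <= B%:R.
Proof.
pose c (f : {ffun I -> 'I_M.+1}) := \prod_i (b i)^-1 ^+ f i.
pose chi (f : {ffun I -> 'I_M.+1}) := \prod_i w i ^+ f i.
have chi1 f : `|chi f| = 1.
  by rewrite normr_prod big1 // => i _; rewrite normrX w1 expr1n.
have c1 f : `|c f| ^+ 2 = 1.
  by rewrite normr_prod big1 ?expr1n // => i _; rewrite normrX normfV b1 invr1 expr1n.
have w0 i : w i != 0 by rewrite -normr_eq0 w1 oner_eq0.
have chi_inj : injective chi.
  move=> f f' ff'; apply/ffunP => i.
  have /w_indep/(_ i)/eqP : \prod_i w i ^ ((f i : nat)%:Z - (f' i : nat)%:Z) = 1.
    under eq_bigr do rewrite expfzDr // -invr_expz -!exprnP.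
    rewrite big_split /= -/(chi f) ff' prodfV /chi mulfV //.
    by apply/prodf_neq0 => j _; rewrite expf_neq0.
  by rewrite subr_eq0 => /eqP[] /val_inj.
have [B hB] := @mean_square _ (@box M J) c chi chi1 (in2W chi_inj).
exists B => K; move: (hB K).
rewrite (eq_bigr _ (fun f _ => c1 f)) sumr_const -card_box.
congr (`| _ - _ | <= _); apply: eq_bigr => k _; congr (`|_| ^+ 2).
transitivity (\prod_i \sum_(a < M.+1 | J i || (a == ord0)) z i k ^+ a).
  rewrite bigA_distr_big_dep; apply: eq_bigr => f _.
  rewrite /c /chi -prodrXl -big_split /=; apply: eq_bigr => i _.
  by rewrite /z exprMn -!exprM mulrC mulnC.
rewrite (bigID J) /= [X in _ * X]big1 ?mulr1; last first.
  by move=> i /negbTE ->; rewrite big_pred1_eq expr0.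
by apply: eq_bigr => i ->.
Qed.

Lemma real_dist_le (x y B : C) : x \is Num.real -> y \is Num.real ->
  `|x - y| <= B -> x <= y + B /\ y <= x + B.
Proof.
move=> xr yr h; split; rewrite -lerBlDl; apply: le_trans h.
  by rewrite real_ler_norm ?rpredB.
by rewrite distrC real_ler_norm ?rpredB.
Qed.

(* The product [P] of the [Q i = \sum_(a <= M) z i ^ a] concentrates where all
   [z i] are close to 1: multiplying by [1 - z i] telescopes [Q i], which divides
   the mean of [`|P| ^ 2] by a factor of order [M]. *)
Theorem kronecker (e : R) : 0 < e ->
  exists k : nat, forall i, `|w i ^+ k - b i| < e%:C%C.
Proof.
move=> e0; apply: contrapT => noK.
have e0C : 0 < e%:C%C :> C by rewrite ltcR.
have far k : exists i, e%:C%C <= `|1 - z i k|.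
  apply: contrapT => ni; apply: noK; exists k => i.
  have -> : w i ^+ k - b i = - b i * (1 - z i k).
    rewrite /z mulrBr mulr1 mulNr opprK addrC mulrCA mulfV ?mulr1 //.
    by rewrite -normr_eq0 b1 oner_eq0.
  rewrite normrM normrN b1 mul1r real_ltNge ?normr_real ?(ger0_real (ltW e0C)) //.
  by apply/negP => le; apply: ni; exists i.
have [i0 _] := far 0%N.
pose n := #|I|.
have n0 : (0 < n)%N by apply/card_gt0P; exists i0.
(* Makes [e ^ 2 * (M + 1)] exceed [4 * n]: the gain from averaging one more factor beats the loss
   from summing over the [n] coordinates that may be far from 1. *)
pose M := Num.bound (4 * n%:R / e ^+ 2).
have hM : 4 * n%:R < e ^+ 2 * M%:R.
  rewrite -ltr_pdivrMl ?exprn_gt0 // mulrC; apply: archi_boundP.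
  by rewrite !mulr_ge0 ?invr_ge0 ?sqr_ge0.
pose Q i k : C := \sum_(a < M.+1) z i k ^+ a.
have [B0 hB0] := mean_box M predT.
have [B hB] := choice (fun i => mean_box M (predC1 i)).
(* At time [k] some [z i k] is at distance at least [e] from 1, and the geometric sum bounds [Q i k]
   by [2 / e]. As [i] depends on [k], the bound sums over all coordinates. *)
have key k : (e ^+ 2)%:C%C * `|\prod_i Q i k| ^+ 2 <=
    \sum_i 4 * `|\prod_(j | predC1 i j) Q j k| ^+ 2.
  have [i hi] := far k.
  rewrite (bigD1 i) //= [leRHS](bigD1 i) //=.
  set r := \prod_(_ | _) _.
  apply: le_trans (_ : 4 * `|r| ^+ 2 <= _); last first.
    by rewrite lerDl sumr_ge0 // => j _; rewrite mulr_ge0 // exprn_ge0.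
  rewrite normrM exprMn mulrA ler_wpM2r ?exprn_ge0 //.
  rewrite rmorphXn -exprMn /=.
  have -> : (4 : C) = 2 ^+ 2 by rewrite -natrX.
  rewrite ler_pXn2r ?nnegrE ?mulr_ge0 ?(ltW e0C) //.
  apply: le_trans (_ : `|1 - z i k| * `|Q i k| <= _); first by rewrite ler_wpM2r.
  rewrite -normrM /Q -normrN -mulNr opprB -subrX1.
  rewrite (le_trans (ler_normB _ _)) // normrX normr1 /z normrM normrX w1 expr1n.
  by rewrite normfV b1 invr1 mul1r expr1n.
have K_bound K : e ^+ 2 * (K%:R * (M.+1 ^ n)%:R - B0%:R) <=
    \sum_i 4 * (K%:R * (M.+1 ^ n.-1)%:R + (B i)%:R).
  rewrite -lecR.
  have -> : (e ^+ 2 * (K%:R * (M.+1 ^ n)%:R - B0%:R))%:C%C =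
     (e ^+ 2)%:C%C * (K%:R * (M.+1 ^ n)%:R - B0%:R) :> C.
    by rewrite [LHS]rmorphM; congr (_ * _); rewrite [LHS]rmorphB [X in X - _]rmorphM !rmorph_nat.
  have -> : (\sum_i 4 * (K%:R * (M.+1 ^ n.-1)%:R + (B i)%:R))%:C%C =
      \sum_i 4 * (K%:R * (M.+1 ^ n.-1)%:R + (B i)%:R) :> C.
    rewrite rmorph_sum; apply: eq_bigr => i _.
    rewrite [LHS]rmorphM rmorph_nat; congr (_ * _).
    by rewrite [LHS]rmorphD [X in X + _]rmorphM !rmorph_nat.
  have sqr_sum_real (J : pred I) : \sum_(k < K) `|\prod_(i | J i) Q i k| ^+ 2 \is Num.real.
    by rewrite ger0_real // sumr_ge0 // => k _; rewrite exprn_ge0.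
  have nat_real : K%:R * (M.+1 ^ n)%:R \is @Num.real C by rewrite ger0_real ?mulr_ge0.
  have nat_real' : K%:R * (M.+1 ^ n.-1)%:R \is @Num.real C by rewrite ger0_real ?mulr_ge0.
  have [_ h0] := real_dist_le (sqr_sum_real predT) nat_real (hB0 K).
  apply: (@le_trans _ _ ((e ^+ 2)%:C%C * \sum_(k < K) `|\prod_i Q i k| ^+ 2)).
    by rewrite ler_wpM2l ?lecR ?sqr_ge0 // lerBlDr.
  rewrite mulr_sumr; apply: le_trans (ler_sum _ (fun (k : 'I_K) _ => key k)) _.
  rewrite exchange_big /=; apply: ler_sum => i _.
  rewrite -mulr_sumr ler_wpM2l //.
  have hc : #|predC1 i| = n.-1 by rewrite cardC1.
  have := hB i K; rewrite hc => hBi.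
  by have [] := real_dist_le (sqr_sum_real (predC1 i)) nat_real' hBi.
pose d := e ^+ 2 * M.+1%:R - 4 * n%:R.
have d0 : 0 < d by rewrite subr_gt0 (lt_trans hM) // ltr_pM2l ?exprn_gt0 // ltr_nat.
pose X : R := (M.+1 ^ n.-1)%:R.
have X1 : 1 <= X by rewrite ler1n expn_gt0.
pose S := e ^+ 2 * B0%:R + \sum_i 4 * (B i)%:R.
have S0 : 0 <= S.
  by rewrite /S addr_ge0 ?mulr_ge0 ?sqr_ge0 ?(ltW e0) ?sumr_ge0 // => i _; rewrite mulr_ge0.
(* The main terms differ by [X * K * d] and the bounded errors total [S], so this [K] contradicts
   [K_bound]. *)
pose K := Num.bound (S / d).
have hK : S < d * K%:R.
  by rewrite -ltr_pdivrMl // mulrC; apply: archi_boundP; rewrite divr_ge0 // ltW.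
have := K_bound K.
under eq_bigr do rewrite mulrDr.
rewrite big_split /= sumr_const -/n -{1}(prednK n0) expnS natrM -/X -mulr_natr.
apply/negP; rewrite -ltNge -subr_gt0.
rewrite (_ : _ - _ = X * K%:R * d - S); last by rewrite /S /d; ring.
by rewrite subr_gt0 (lt_le_trans hK) // -mulrA [K%:R * d]mulrC ler_peMl // mulr_ge0 ?(ltW d0).
Qed.

End Kronecker.

(** * Linear independence of square roots *)

Definition is_square (N : nat) : Prop := exists s : nat, N = (s ^ 2)%N.

(** For distinct primes these are the square-free numbers with prime factors in [l], each listed
    once, beginning with 1. *)
Fixpoint subproducts (l : seq nat) : seq nat :=
  if l is p :: l' then subproducts l' ++ [seq (p * d)%N | d <- subproducts l']
  else [:: 1%N].

Lemma subproducts_cons1 l : subproducts l = 1%N :: behead (subproducts l).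
Proof. by elim: l => //= p l ->. Qed.

Lemma sqr_rat_nat (q : rat) (N : nat) : q ^+ 2 = N%:R -> is_square N.
Proof.
move=> qN; exists `|numq q|%N.
have dn : (`|denq q| ^ 2 %| `|numq q| ^ 2)%N.
  apply/dvdnP; exists N.
  have : (numq q ^+ 2)%:~R = (N%:Z * denq q ^+ 2)%:~R :> rat.
    rewrite [RHS]rmorphM !rmorphXn /= -[N%:Z%:~R]/(N%:R : rat) -qN -{2}(divq_num_den q).
    by rewrite expr_div_n divfK ?sqrf_eq0 ?intr_eq0 ?denq_neq0 //.
  by move/intr_inj => /(congr1 absz); rewrite abszX abszM abszX absz_nat.
have d1 : `|denq q|%N = 1%N.
  have := coprime_num_den q => cop.
  have : coprime (`|denq q| ^ 2) (`|numq q| ^ 2).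
    by rewrite coprimeXl // coprimeXr // coprime_sym.
  rewrite /coprime (gcdn_idPl dn) => /eqP.
  by move/eqP; rewrite -[X in _ == X](exp1n 2) eqn_exp2r // => /eqP.
have d1' : denq q = 1 by rewrite -[LHS]gez0_abs ?denq_ge0 // d1.
have : (numq q ^+ 2)%:~R = N%:Z%:~R :> rat.
  by rewrite rmorphXn /= -[RHS]/(N%:R : rat) -qN -{2}(divq_num_den q) d1' divr1.
by move/intr_inj => /(congr1 absz); rewrite abszX absz_nat => <-.
Qed.

Section MultiquadraticField.
Variable R : rcfType.
Implicit Types (x y : R) (l : seq nat).

Local Notation sqrtn n := (Num.sqrt (n%:R : R)).

Lemma sqr_sqrtn (n : nat) : sqrtn n ^+ 2 = n%:R.
Proof. by rewrite sqr_sqrtr. Qed.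

Lemma sqrtnM (m n : nat) : sqrtn (m * n)%N = sqrtn m * sqrtn n.
Proof. by rewrite natrM sqrtrM. Qed.

(** The field generated over the rationals by the square roots of the entries of [l], as a tower of
    extensions of degree at most two. *)
Fixpoint multiquad l : R -> Prop :=
  if l is p :: l' then fun x => exists a b,
    [/\ multiquad l' a, multiquad l' b & x = a + b * sqrtn p]
  else fun x => exists q : rat, x = ratr q.

Lemma multiquad_rat l q : multiquad l (ratr q).
Proof.
elim: l q => [|p l IHl] q; first by exists q.
by exists (ratr q), (ratr 0); split => //; rewrite rmorph0 mul0r addr0.
Qed.

Lemma multiquad0 l : multiquad l 0.
Proof. by rewrite -[0](rmorph0 ratr); exact: multiquad_rat. Qed.

Lemma multiquad_nat l (n : nat) : multiquad l n%:R.
Proof. by rewrite -(ratr_nat R n); exact: multiquad_rat. Qed.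

Lemma multiquad_cons p l x : multiquad l x -> multiquad (p :: l) x.
Proof. by move=> lx; exists x, 0; split=> //; [exact: multiquad0|rewrite mul0r addr0]. Qed.

Lemma multiquadD l x y : multiquad l x -> multiquad l y -> multiquad l (x + y).
Proof.
elim: l x y => [|p l IHl] x y /=.
  by move=> [q ->] [q' ->]; exists (q + q'); rewrite rmorphD.
move=> [a [b [la lb ->]]] [a' [b' [la' lb' ->]]].
by exists (a + a'), (b + b'); split; [exact: IHl|exact: IHl|ring].
Qed.

Lemma multiquadM l x y : multiquad l x -> multiquad l y -> multiquad l (x * y).
Proof.
elim: l x y => [|p l IHl] x y /=.
  by move=> [q ->] [q' ->]; exists (q * q'); rewrite rmorphM.
move=> [a [b [la lb ->]]] [a' [b' [la' lb' ->]]].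
exists (a * a' + p%:R * (b * b')), (a * b' + a' * b); split.
- by apply: multiquadD; [|apply: (IHl); [exact: multiquad_nat|]]; exact: IHl.
- by apply: multiquadD; exact: IHl.
- by have := sqr_sqrtn p; move: (sqrtn p) => t <-; ring.
Qed.

Lemma multiquadN l x : multiquad l x -> multiquad l (- x).
Proof.
by move=> lx; rewrite -mulN1r -(rmorphN1 ratr); apply: multiquadM => //; exact: multiquad_rat.
Qed.

(** One multiplies by the conjugate [a - b sqrt p]. If the norm vanishes and [b != 0], then [sqrt p]
    already lies in the smaller field, and so does the element to be inverted. *)
Lemma multiquadV l x : multiquad l x -> multiquad l x^-1.
Proof.
elim: l x => [|p l IHl] x /=; first by move=> [q ->]; exists q^-1; rewrite fmorphV.
move=> [a [b [la lb ->]]].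
have lB : multiquad l (- b) by exact: multiquadN.
have [n0|n0] := eqVneq (a ^+ 2 - p%:R * b ^+ 2) 0.
  have [b0|b0] := eqVneq b 0.
    by rewrite b0 mul0r addr0; apply: multiquad_cons; exact: IHl.
  apply: (@multiquad_cons p l); apply: (IHl); apply: multiquadD => //.
  apply: multiquadM => //.
  have : (sqrtn p - a / b) * (sqrtn p + a / b) = 0.
    have -> : (sqrtn p - a / b) * (sqrtn p + a / b) = p%:R - a ^+ 2 / b ^+ 2.
      by have := sqr_sqrtn p; move: (sqrtn p) => t <-; field.
    by move/eqP: n0; rewrite subr_eq0 => /eqP ->; rewrite mulfK ?subrr ?expf_neq0.
  move/eqP; rewrite mulf_eq0 subr_eq0 addr_eq0 => /orP[] /eqP ->.
    by apply: multiquadM => //; exact: IHl.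
  by apply: multiquadN; apply: multiquadM => //; exact: IHl.
set n := _ - _ in n0.
exists (a * n^-1), (- b * n^-1).
have lV : multiquad l n^-1.
  apply: (IHl); apply: multiquadD; first by rewrite expr2; exact: multiquadM.
  apply: multiquadN; apply: multiquadM; first exact: multiquad_nat.
  by rewrite expr2; exact: multiquadM.
split; [exact: multiquadM|exact: multiquadM|].
have nE : n = (a + b * sqrtn p) * (a - b * sqrtn p) by rewrite /n; have := sqr_sqrtn p; move: (sqrtn p) => t <-; ring.
have n1 : a + b * sqrtn p != 0 by move: n0; rewrite nE mulf_eq0 negb_or => /andP[].
have n2 : a - b * sqrtn p != 0 by move: n0; rewrite nE mulf_eq0 negb_or => /andP[].
by rewrite nE; field; rewrite n1 n2.
Qed.

(** Arithmetic condition ensuring that each step of the tower is a proper quadratic extension. *)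
Fixpoint sqrt_independent l : Prop :=
  if l is p :: l' then
    sqrt_independent l' /\ (forall d, d \in subproducts l' -> ~ is_square (p * d))
  else True.

(** If [sqrt N = a + b sqrt p] with [a] and [b] nonzero, squaring puts [sqrt p] in the smaller
    field. If one of them vanishes, [sqrt N] or [sqrt (N p)] lies there, which the induction
    hypothesis excludes. *)
Lemma sqrt_notin_multiquad l : sqrt_independent l -> forall N : nat,
  (forall d, d \in subproducts l -> ~ is_square (N * d)) -> ~ multiquad l (sqrtn N).
Proof.
elim: l => [_ N hN|p l IHl [hl hp] N hN] /=.
  move=> [q /(congr1 (fun x => x ^+ 2))]; rewrite sqr_sqrtn -rmorphXn /=.
  rewrite -(ratr_nat R N) => /fmorph_inj /esym /sqr_rat_nat sqN.
  by apply: (hN 1%N); rewrite ?inE ?muln1.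
have hpl : ~ multiquad l (sqrtn p) by exact: IHl.
have hN1 d : d \in subproducts l -> ~ is_square (N * d).
  by move=> ld; apply: hN; rewrite /= mem_cat ld.
have hN2 d : d \in subproducts l -> ~ is_square (N * p * d).
  by move=> ld; rewrite -mulnA; apply: hN; rewrite /= mem_cat map_f ?orbT.
move=> [a [b [la lb]]].
have [-> E|b0] := eqVneq b 0.
  by apply: (IHl hl N hN1); rewrite E mul0r addr0.
have [-> E|a0] := eqVneq a 0.
  apply: (IHl hl (N * p)%N hN2); rewrite sqrtnM E add0r -mulrA -expr2 sqr_sqrtn.
  by apply: multiquadM => //; exact: multiquad_nat.
move=> /(congr1 (fun x => x ^+ 2)); rewrite sqr_sqrtn => E.
apply: hpl.
have -> : sqrtn p = (N%:R - (a * a + p%:R * (b * b))) * (2%:R * (a * b))^-1.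
  rewrite E; have := sqr_sqrtn p; move: (sqrtn p) => t <-.
  by field; rewrite a0 b0.
have lab : multiquad l (a * b) by exact: multiquadM.
apply: multiquadM; last by apply: multiquadV; apply: multiquadM => //; exact: multiquad_nat.
apply: multiquadD; first exact: multiquad_nat.
apply/multiquadN/multiquadD; first exact: multiquadM.
by apply: multiquadM; [exact: multiquad_nat|exact: multiquadM].
Qed.

Lemma multiquad_sum l (c : nat -> rat) :
  multiquad l (\sum_(d <- subproducts l) ratr (c d) * sqrtn d).
Proof.
elim: l c => [|p l IHl] c /=.
  by exists (c 1%N); rewrite big_seq1 sqrtr1 mulr1.
exists (\sum_(d <- subproducts l) ratr (c d) * sqrtn d).
exists (\sum_(d <- subproducts l) ratr (c (p * d)%N) * sqrtn d).
split; [exact: IHl|exact: (IHl (fun d => c (p * d)%N))|].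
rewrite big_cat big_map /= mulr_suml; congr (_ + _); apply: eq_bigr => d _.
by rewrite sqrtnM; ring.
Qed.

(** The sum splits as [S1 + sqrt p * S2] with both parts in the smaller field; a nonzero [S2] would
    put [sqrt p] there. *)
Lemma sqrt_lin_indep l (c : nat -> rat) : sqrt_independent l ->
  \sum_(d <- subproducts l) ratr (c d) * sqrtn d = 0 ->
  forall d, d \in subproducts l -> c d = 0.
Proof.
elim: l c => [|p l IHl] c /=.
  rewrite big_seq1 sqrtr1 mulr1 => _ /eqP; rewrite fmorph_eq0 => /eqP c1 d.
  by rewrite inE => /eqP ->.
move=> [hl hp]; rewrite big_cat big_map /=.
have -> : \sum_(d <- subproducts l) ratr (c (p * d)%N) * sqrtn (p * d)%N =
    sqrtn p * \sum_(d <- subproducts l) ratr (c (p * d)%N) * sqrtn d.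
  by rewrite mulr_sumr; apply: eq_bigr => d _; rewrite sqrtnM mulrCA.
have := multiquad_sum l (fun d => c (p * d)%N).
have := multiquad_sum l c.
set S1 := \sum_(_ <- _) _; set S2 := \sum_(_ <- _) _ => l1 l2.
have [S20|S20] := eqVneq S2 0.
  rewrite S20 mulr0 addr0 => S10 d; rewrite mem_cat => /orP[|/mapP[d' hd' ->]].
    exact: IHl.
  exact: (IHl (fun d => c (p * d)%N)).
move=> /eqP; rewrite addr_eq0 -eqr_oppLR => /eqP E.
case: (sqrt_notin_multiquad hl hp).
have -> : sqrtn p = - S1 / S2 by rewrite E mulfK.
by apply: multiquadM; [exact: multiquadN|exact: multiquadV].
Qed.

End MultiquadraticField.

(** * Square-free products of primes *)

Lemma mem_subproducts_prime l d q : all prime l -> prime q ->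
  d \in subproducts l -> (0 < d)%N /\ (q %| d -> q \in l)%N.
Proof.
move=> + pq; elim: l d => [|p l IHl] d /=.
  by rewrite inE => _ /eqP ->; split=> //; rewrite dvdn1 => /eqP q1; rewrite q1 in pq.
move=> /andP[pp pl]; rewrite mem_cat inE => /orP[/(IHl _ pl)[d0 hd]|].
  by split=> // /hd ->; rewrite orbT.
move=> /mapP[d' /(IHl _ pl)[d0 hd] ->]; split; first by rewrite muln_gt0 prime_gt0.
by rewrite Euclid_dvdM // dvdn_prime2 // => /orP[->//|/hd ->]; rewrite orbT.
Qed.

(** In [p * d] the valuation at [p] is 1, hence odd, because [d] is prime to [p]. *)
Lemma sqrt_independent_primes l : all prime l -> uniq l -> sqrt_independent l.
Proof.
elim: l => //= p l IHl /andP[pp pl] /andP[npl ul]; split; first exact: IHl.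
move=> d /(mem_subproducts_prime pl pp)[d0 hd] [s E].
have pd : ~~ (p %| d)%N by apply: contra npl.
have := congr1 (fun n => odd (logn p n)) E.
by rewrite /= lognX lognM ?(prime_gt0 pp) // logn_prime // eqxx logn_coprime ?prime_coprime // oddM.
Qed.

Lemma uniq_subproducts l : all prime l -> uniq l -> uniq (subproducts l).
Proof.
elim: l => //= p l IHl /andP[pp pl] /andP[npl ul].
rewrite cat_uniq (IHl pl ul) /= map_inj_uniq ?(IHl pl ul) ?andbT; last first.
  by move=> x y /eqP; rewrite eqn_pmul2l ?prime_gt0 // => /eqP.
apply/hasPn => _ /mapP[d _ ->]; apply/negP => /(mem_subproducts_prime pl pp)[_].
by rewrite dvdn_mulr // (negbTE npl) => /(_ isT).
Qed.

Lemma subproducts_sqfree l q d : all prime l -> uniq l -> prime q ->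
  d \in subproducts l -> ~~ (q ^ 2 %| d)%N.
Proof.
move=> + + pq; elim: l d => [|p l IHl] d /=.
  by rewrite inE => _ _ /eqP ->; rewrite dvdn1 -[X in _ == X](exp1n 2) eqn_exp2r // gtn_eqF ?prime_gt1.
move=> /andP[pp pl] /andP[npl ul]; rewrite mem_cat => /orP[|/mapP[d' hd ->]]; first exact: IHl.
have [qp|qp] := eqVneq q p.
  rewrite qp -mulnn dvdn_pmul2l ?prime_gt0 //.
  by have [_ h] := mem_subproducts_prime pl pp hd; apply: contra npl.
rewrite Gauss_dvdr; first exact: IHl.
by rewrite coprimeXl // prime_coprime // dvdn_prime2.
Qed.

(** The full power of [p] is removed from [N], and [p] enters the square-free part exactly when its
    exponent is odd. *)
Lemma sqfree_decomp l N : all prime l -> (0 < N)%N ->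
  (forall q, prime q -> q %| N -> q \in l)%N ->
  exists D s : nat, D \in subproducts l /\ N = (D * s ^ 2)%N.
Proof.
elim: l N => [|p l IHl] N /=.
  move=> _ N0 hN; exists 1%N, 1%N; split=> //; apply/eqP; rewrite muln1; apply: contraT => N1.
  have := hN (pdiv N) _ (pdiv_dvd N); rewrite pdiv_prime ?inE => [/(_ isT)//|].
  by rewrite ltn_neqAle eq_sym N1.
move=> /andP[pp pl] N0 hN.
have [m cpm E] := pfactor_coprime pp N0.
have m0 : (0 < m)%N by move: N0; rewrite E muln_gt0 => /andP[].
have [|D [s [hD mE]]] := IHl m pl m0.
  move=> q pq qm; have := hN q pq; rewrite E dvdn_mulr // inE => /(_ isT)/orP[/eqP qp|//].
  by move: cpm; rewrite prime_coprime // -qp qm.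
pose e := logn p N.
have pe : (p ^ e = p ^ odd e * (p ^ e./2) ^ 2)%N.
  by rewrite -expnM -expnD muln2 odd_double_half.
case oe : (odd e).
  exists (p * D)%N, (s * p ^ e./2)%N; split; first by rewrite mem_cat map_f ?orbT.
  by rewrite [LHS]E -/e pe oe mE expnMn expn1; ring.
exists D, (s * p ^ e./2)%N; split; first by rewrite mem_cat hD.
by rewrite [LHS]E -/e pe oe mE expnMn mul1n mulnA.
Qed.

(** A multiplicative relation between the phases is an integral linear relation between 1 and the
    roots [sqrt d]. The value [d = 1] is left out, its phase being constantly 1. *)
Lemma kronecker_sqrt (R : realType) (l : seq nat) (b : nat -> R[i]) (e : R) :
  all prime l -> uniq l -> (forall d, `|b d| = 1) -> 0 < e ->
  exists k : nat, forall d, d \in subproducts l -> d != 1%N ->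
    `|expi (2 * pi * Num.sqrt d%:R * k%:R) - b d| < e%:C%C.
Proof.
move=> pl ul b1 e0; pose s := behead (subproducts l).
pose w (i : 'I_(size s)) := expi (2 * pi * Num.sqrt (nth 0%N s i)%:R : R).
have us : uniq (1%N :: s) by rewrite -subproducts_cons1; exact: uniq_subproducts.
have [|k hk] := @kronecker R _ w (fun i => b (nth 0%N s i)) (fun i => norm_expi _) (fun i => b1 _) _ e e0; last first.
  exists k => d; rewrite subproducts_cons1 inE => /orP[/eqP -> //|sd _].
  have hi : (index d s < size s)%N by rewrite index_mem.
  by have := hk (Ordinal hi); rewrite /w /= nth_index // expiX.
move=> m.
have -> : \prod_i w i ^ m i = expi (2 * pi * \sum_i (m i)%:~R * Num.sqrt (nth 0%N s i)%:R).
  rewrite mulr_sumr; elim/big_rec2 : _ => [|i y x _ ->]; first by rewrite expi0.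
  by rewrite expiD /w expiXz; congr (expi _ * _); ring.
move=> /expi_eq1[n /mulfI]; rewrite mulf_neq0 ?gt_eqF ?pi_gt0 // => /(_ isT) E.
(* The coefficient at 1 absorbs the integer [n] coming from the period 2 pi. *)
pose c d : rat := if d == 1%N then (- n)%:~R else
  if insub (index d s) is Some i then (m i)%:~R else 0.
have cE (i : 'I_(size s)) : c (nth 0%N s i) = (m i)%:~R.
  rewrite /c; case: eqP => [i1|_].
    by move: us; rewrite /= -[X in X \notin _]i1 mem_nth.
  rewrite index_uniq //; last by case/andP: us.
  by rewrite (insubT (fun x => x < size s)%N (ltn_ord i)); congr (m _)%:~R; exact: val_inj.
have /sqrt_lin_indep-/(_ (sqrt_independent_primes pl ul)) h :
    \sum_(d <- subproducts l) ratr (c d) * Num.sqrt (d%:R : R) = 0.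
  rewrite subproducts_cons1 big_cons -/s (big_nth 0%N) big_mkord sqrtr1 mulr1.
  rewrite {1}/c eqxx ratr_int mulrNz -E.
  apply/eqP; rewrite addrC subr_eq0; apply/eqP; apply: eq_bigr => i _.
  by rewrite cE ratr_int.
move=> i; apply/eqP; rewrite -(intr_eq0 rat) -cE; apply/eqP/h.
by rewrite subproducts_cons1 inE mem_nth ?orbT.
Qed.

(* Viewing a solution of [x ^ 2 + 1 = D s ^ 2] as a unit [x + s sqrt D] of norm
   -1, the step divides the larger unit by the square of the smaller one. *)
Lemma pell_odd_ratio (x y z : int) : x != 0 -> y != 0 ->
  (x ^+ 2 + 1) * (y ^+ 2 + 1) = z ^+ 2 ->
  exists i j : int, (2 * i + 1) * x = (2 * j + 1) * y.
Proof.
have [n] := ubnP (`|x| + `|y|)%N.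
elim: n x y z => // n IHn x y z.
wlog x0 : x / 0 < x.
  move=> wl hn x0 y0 E; have [xp|xn] := ltP 0 x; first exact: wl.
  have [|||||i [j ij]] := wl (- x); rewrite ?abszN ?oppr_eq0 ?sqrrN //; first lia.
  by exists (- i - 1), j; rewrite -ij; ring.
wlog y0 : y / 0 < y.
  move=> wl hn _ y0 E; have [yp|yn] := ltP 0 y; first by apply: wl => //; lia.
  have [|||||i [j ij]] := wl (- y); rewrite ?abszN ?oppr_eq0 ?sqrrN //; [lia|lia|].
  by exists i, (- j - 1); rewrite ij; ring.
wlog z0 : z / 0 <= z.
  move=> wl hn xn yn E; have [zp|zn] := leP 0 z; first exact: (wl z).
  by apply: (wl (- z)); rewrite ?sqrrN // oppr_ge0 ltW.
wlog xy : x y x0 y0 / x <= y.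
  move=> wl hn xn yn E; have [xy|yx] := leP x y; first exact: wl.
  have hn' : (`|y| + `|x| < n.+1)%N by rewrite addnC.
  have E' : (y ^+ 2 + 1) * (x ^+ 2 + 1) = z ^+ 2 by rewrite mulrC.
  have [i [j ij]] := wl y x y0 x0 (ltW yx) hn' yn xn E'.
  by exists j, i.
move=> hn _ _ E.
have [<-|xny] := eqVneq x y; first by exists 0, 0.
have {xny} xy : x < y by rewrite lt_neqAle xny.
(* With [w = sqrt (x ^ 2 + 1)] and [sqrt (y ^ 2 + 1) = z / w], the product [(y + z / w) (x - w) ^ 2]
   equals [y' + z' / w]. *)
pose y' := y * (2 * x ^+ 2 + 1) - 2 * x * z.
pose z' := z * (2 * x ^+ 2 + 1) - 2 * x * y * (x ^+ 2 + 1).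
have E' : (x ^+ 2 + 1) * (y' ^+ 2 + 1) = z' ^+ 2.
  have : z' ^+ 2 - (x ^+ 2 + 1) * (y' ^+ 2 + 1) =
      (z ^+ 2 - (x ^+ 2 + 1) * (y ^+ 2 + 1)) * ((2 * x ^+ 2 + 1) ^+ 2 - 4 * x ^+ 2 * (x ^+ 2 + 1)).
    by rewrite /z' /y'; ring.
  by rewrite -E subrr mul0r => /eqP; rewrite subr_eq0 => /eqP ->.
have xyz : x * y < z.
  suff : (x * y) ^+ 2 < z ^+ 2 by rewrite ltr_pXn2r ?nnegrE ?mulr_ge0 // ltW.
  rewrite -E -subr_gt0 [X in 0 < X](_ : _ = x ^+ 2 + y ^+ 2 + 1); last by ring.
  by rewrite ltr_wpDl ?addr_ge0 ?sqr_ge0.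
have yxz : x * z < y * (x ^+ 2 + 1).
  suff : (x * z) ^+ 2 < (y * (x ^+ 2 + 1)) ^+ 2.
    by rewrite ltr_pXn2r ?nnegrE ?mulr_ge0 ?addr_ge0 ?sqr_ge0 // ltW.
  rewrite exprMn -E -subr_gt0.
  rewrite [X in 0 < X](_ : _ = (x ^+ 2 + 1) * ((y - x) * (y + x))); last by ring.
  by rewrite !mulr_gt0 ?subr_gt0 // ?(addr_gt0 y0 x0) // ltr_wpDl ?sqr_ge0.
have y'y : `|y'| < y.
  rewrite ltr_norml /y'; apply/andP; split; rewrite -subr_gt0.
    rewrite [X in 0 < X](_ : _ = 2 * (y * (x ^+ 2 + 1) - x * z)); last by ring.
    by rewrite mulr_gt0 // subr_gt0.
  rewrite [X in 0 < X](_ : _ = 2 * x * (z - x * y)); last by ring.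
  by rewrite !mulr_gt0 // subr_gt0.
(* Otherwise [x ^ 2 + 1] would be a square, which is impossible for [x > 0]. *)
have y'0 : y' != 0.
  apply/eqP => y'0; move: E'; rewrite y'0 expr0n add0r mulr1 => E'.
  have h : (`|z'| - x) * (`|z'| + x) = 1.
    by rewrite -subr_sqr real_normK ?num_real // -E'; ring.
  have w0 := normr_ge0 z'; move: h w0; move: `|z'| => w h w0.
  have wx : 0 < w - x by rewrite -(pmulr_lgt0 _ (_ : 0 < w + x)) ?h // ltr_wpDl.
  have : 1 * (w + x) <= (w - x) * (w + x) by apply: ler_wpM2r; lia.
  by rewrite h; lia.
have [||i [j ij]] := IHn x y' z' _ _ y'0 E'; [by move: y'y hn; lia|by rewrite gt_eqF|].
(* Unfolding [y'] in the inductive relation moves a multiple of [2 x] to the left and multiplies the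
   odd factor of [y] by [2 x ^ 2 + 1], which is odd. *)
exists (i + z * (2 * j + 1)), (j * (2 * x ^+ 2 + 1) + x ^+ 2).
apply/eqP; rewrite -subr_eq0; apply/eqP.
by move/eqP: ij; rewrite -subr_eq0 => /eqP <-; rewrite /y'; ring.
Qed.

(** * Continuous quantum walks *)

Section Transition.
Variable R : realType.
Local Notation C := (R[i] : numFieldType).

Lemma conjC_complex (x : R[i]) : x^* = (x^*)%C.
Proof. by []. Qed.

(** Spectral theorem in coordinates: the rows of [P] form an orthonormal eigenbasis, and the first
    clause is its completeness relation. *)
Lemma adjmx_spectral (H : sgraph) :
  exists (P : 'M[R[i]]_#|H|) (d : 'I_#|H| -> R),
    [/\ forall a b, \sum_j (P j a)^*%C * P j b = (a == b)%:R,
        forall j, \sum_a P j a * (P j a)^*%C = 1 &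
        forall j b, \sum_a P j a * adjmx R[i] H a b = (d j)%:C%C * P j b].
Proof.
set A := adjmx _ _.
have Aherm : A \is hermsymmx.
  apply/is_hermitianmxP; rewrite expr0 scale1r; apply/matrixP => i j.
  by rewrite !mxE adj_sym conjC_nat.
pose P := spectralmx A; pose d := spectral_diag A.
have PU : P \is unitarymx := spectral_unitarymx A.
have PAd : A = invmx P *m diag_mx d *m P := orthomx_spectralP (hermitian_normalmx Aherm).
exists P, (fun j => complex.Re (d 0 j)); split.
- move=> a b.
  have : invmx P *m P = 1%:M by rewrite mulVmx ?spectral_unit.
  rewrite invmx_unitary // => /matrixP/(_ a b); rewrite !mxE => <-.
  by apply: eq_bigr => j _; rewrite !mxE.
- move=> j.
  have /unitarymxP/matrixP/(_ j j) := PU; rewrite !mxE eqxx => h; rewrite -[RHS]/(true%:R) -h.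
  by apply: eq_bigr => a _; rewrite !mxE.
move=> j b.
have : P *m A = diag_mx d *m P by rewrite PAd !mulmxA mulmxV ?spectral_unit // mul1mx.
move/matrixP/(_ j b); rewrite mul_diag_mx !mxE => ->; congr (_ * _).
have := hermitian_spectral_diag_real Aherm; rewrite -/d => /mxOverP/(_ 0 j).
by move=> /RRe_real ->.
Qed.

Lemma cvg_exp_sum (J : finType) (q : J -> R[i]) (th : J -> R) (t : R) :
  (series (fun k => (k`!%:R)^-1 * ((- ('i * t%:C)%C) ^+ k * \sum_j q j * (th j)%:C%C ^+ k) : C) @ \oo
    --> (\sum_j q j * expi (- (t * th j)) : C))%classic.
Proof.
have -> : series (fun k => (k`!%:R)^-1 * ((- ('i * t%:C)%C) ^+ k * \sum_j q j * (th j)%:C%C ^+ k) : C) =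
    (fun K => \sum_j q j * series (fun k => (k`!%:R)^-1 * (- ('i * (t * th j)%:C)%C) ^+ k : C) K).
  apply/funext => K; rewrite /series /=.
  under [RHS]eq_bigr do rewrite mulr_sumr.
  rewrite exchange_big /=; apply: eq_bigr => k _.
  rewrite !mulr_sumr; apply: eq_bigr => j _.
  have -> : (- ('i * (t * th j)%:C)%C) = - ('i * t%:C)%C * (th j)%:C%C :> R[i].
    by rewrite rmorphM mulNr mulrA.
  by rewrite exprMn; ring.
apply: cvg_big => [|j _]; first exact: add_continuous.
by apply: cvgMr; exact: cvg_expi.
Qed.

Lemma adjmx_pow_spectral (H : sgraph) (P : 'M[R[i]]_#|H|) (d : 'I_#|H| -> R) :
  (forall a b, \sum_j (P j a)^*%C * P j b = (a == b)%:R) ->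
  (forall j b, \sum_a P j a * adjmx R[i] H a b = (d j)%:C%C * P j b) ->
  forall k a b, (adjmx R[i] H ^+ k) a b = \sum_j (P j a)^*%C * P j b * (d j)%:C%C ^+ k.
Proof.
move=> hP hd; elim=> [|k IHk] a b.
  by rewrite expr0 mxE -hP; apply: eq_bigr => j _; rewrite mulr1.
rewrite exprSr mxE; under eq_bigr do rewrite IHk mulr_suml.
rewrite exchange_big /=; apply: eq_bigr => j _.
rewrite exprSr [_ ^+ k * _]mulrC mulrA -[_ * P j b * _]mulrA [P j b * _]mulrC -hd.
by rewrite mulr_sumr mulr_suml; apply: eq_bigr => c _; ring.
Qed.

(** [transition] is defined as a limit and is meaningful only once the series converges; the
    spectral decomposition gives this entry by entry. *)
Lemma transition_cvg (H : sgraph) (t : R) a b :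
  (series (fun k => (k`!%:R)^-1 * ((- ('i * t%:C)%C) ^+ k * (adjmx R[i] H ^+ k) a b) : C) @ \oo
    --> (transition H t a b : C))%classic.
Proof.
have [P [d [hP _ hd]]] := adjmx_spectral H.
pose L : 'M[C]_#|H| := \matrix_(a, b) \sum_j (P j a)^*%C * P j b * expi (- (t * d j)).
have cv a' b' : (series (fun k => (k`!%:R)^-1 * ((- ('i * t%:C)%C) ^+ k * (adjmx R[i] H ^+ k) a' b') : C) @ \oo
    --> (L a' b' : C))%classic.
  under eq_fun do rewrite (adjmx_pow_spectral hP hd).
  by rewrite mxE; exact: cvg_exp_sum.
suff -> : transition H t = L by exact: cv.
apply: mexp_entries => a' b'.
suff E k : (- ('i * t%:C)%C *: adjmx R[i] H) ^+ k = (- ('i * t%:C)%C) ^+ k *: adjmx R[i] H ^+ k.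
  by under eq_fun do rewrite E mxE; exact: cv.
elim: k => [|k IHk]; first by rewrite !expr0 scale1r.
by rewrite !exprS IHk -[LHS]scalemxAl -scalemxAr scalerA.
Qed.

(** Any expression of the entries of the powers as moments of finitely many real nodes will do; no
    eigenbasis of [H] itself has to be exhibited. *)
Lemma transition_exp_sum (H : sgraph) a b (J : finType) (q : J -> R[i]) (th : J -> R) :
  (forall k, (adjmx R[i] H ^+ k) a b = \sum_j q j * (th j)%:C%C ^+ k) ->
  forall t, transition H t a b = \sum_j q j * expi (- (t * th j)).
Proof.
move=> hq t; have := @transition_cvg H t a b.
under eq_fun do rewrite hq.
move=> h1; have h2 := @cvg_exp_sum _ q th t.
exact: (cvg_unique (@norm_hausdorff _ _) h1 h2).
Qed.

(** The vector need not be a row of [P]: it is expanded in that basis, and its coordinates vanish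
    wherever [d j] differs from [lam]. *)
Lemma eigen_transition (H : sgraph) (x : 'I_#|H| -> R[i]) (lam t : R) :
  (forall b, \sum_a x a * adjmx R[i] H a b = lam%:C%C * x b) ->
  forall b, \sum_a x a * transition H t a b = expi (- (t * lam)) * x b.
Proof.
move=> hx b.
have [P [d [hP _ hd]]] := adjmx_spectral H.
pose y j := \sum_a x a * (P j a)^*%C.
have ylam j : y j != 0 -> d j = lam.
  move=> y0; suff : (lam%:C%C - (d j)%:C%C) * y j = 0.
    move/eqP; rewrite mulf_eq0 (negbTE y0) orbF subr_eq0 => /eqP h.
    by move: h => /(congr1 (fun z => complex.Re z)).
  apply/eqP; rewrite mulrBl subr_eq0 /y !mulr_sumr; apply/eqP.
  under eq_bigr do rewrite mulrA -hx mulr_suml.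
  rewrite exchange_big /=; apply: eq_bigr => a _.
  rewrite mulrCA; have -> : (d j)%:C%C * (P j a)^*%C = ((d j)%:C%C * P j a)^*%C.
    by rewrite -!conjC_complex rmorphM; congr (_ * _); exact: esym (conjc_real _).
  rewrite -hd -conjC_complex rmorph_sum mulr_sumr; apply: eq_bigr => c _.
  rewrite rmorphM /= -mulrA [_^* * _]mulrC; congr (_ * (_ * _)).
  by rewrite !mxE adj_sym conjC_nat.
have xE c : x c = \sum_j y j * P j c.
  rewrite /y; under eq_bigr do rewrite mulr_suml.
  rewrite exchange_big /=.
  transitivity (\sum_a x a * (a == c)%:R); last first.
    by apply: eq_bigr => a _; rewrite -hP mulr_sumr; apply: eq_bigr => j _; rewrite mulrA.
  rewrite (bigD1 c) //= eqxx mulr1 big1 ?addr0 // => a /negbTE ->.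
  by rewrite mulr0.
under eq_bigr do rewrite (transition_exp_sum (fun k => adjmx_pow_spectral hP hd k _ _)) mulr_sumr.
rewrite exchange_big /= [in RHS]xE mulr_sumr; apply: eq_bigr => j _.
under eq_bigr do rewrite !mulrA.
rewrite -!mulr_suml -/(y j).
have [->|/ylam ->] := eqVneq (y j) 0; first by rewrite !(mul0r, mulr0).
by rewrite mulrC mulrA.
Qed.

(** Pairing the transfer with an eigenvector relates its entries at [u] and [v] through the unknown
    [gam]; the constant vector, of eigenvalue [r], identifies [gam]. *)
Lemma PST_eigenvector (G : sgraph) (r : nat) (u v : G) (t : R)
    (x : 'I_#|G| -> R[i]) (lam : R) :
  regular G r -> PST u v t ->
  (forall b, \sum_a x a * adjmx R[i] G a b = lam%:C%C * x b) ->
  x (enum_rank v) = expi (t * (r%:R - lam)) * x (enum_rank u).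
Proof.
move=> Greg [uv [gam _ hgam]] hx.
have trans (y : 'I_#|G| -> R[i]) nu :
    (forall b, \sum_a y a * adjmx R[i] G a b = nu%:C%C * y b) ->
    expi (- (t * nu)) * y (enum_rank u) = gam * y (enum_rank v).
  move=> hy; rewrite -(eigen_transition t hy).
  have tE a : transition G t a (enum_rank u) = gam * (a == enum_rank v)%:R.
    move: hgam => /matrixP/(_ a 0); rewrite !mxE /charvec andbT => <-.
    rewrite (bigD1 (enum_rank u)) //= big1 ?addr0 => [|b bu].
      by rewrite !mxE !eqxx mulr1.
    by rewrite !mxE (negbTE bu) mulr0.
  rewrite (bigD1 (enum_rank v)) //= big1 ?addr0 => [|a av].
    by rewrite tE eqxx mulr1 mulrC.
  by rewrite tE (negbTE av) !mulr0.
have gamE : gam = expi (- (t * r%:R)).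
  have := trans (fun=> 1) r%:R; rewrite !mulr1 => -> // b.
  rewrite rmorph_nat -(Greg (enum_val b)) -[in RHS]sum1_card natr_sum.
  rewrite (reindex (@enum_rank G)) /=; last exact: onW_bij (enum_rank_bij _).
  rewrite [in RHS]big_mkcond /=; apply: eq_bigr => a _.
  by rewrite mul1r mxE enum_rankK adj_sym unfold_in /=; case: adj.
have := trans x lam hx; rewrite gamE => h.
have -> : t * (r%:R - lam) = t * r%:R + - (t * lam) by ring.
rewrite expiD -mulrA h mulrA -expiD subrr expi0 mul1r //.
Qed.
End Transition.

(** * The Q-graph *)

Section QgraphAction.
Variables (K : comNzRingType) (G : sgraph).

Definition vertex_row (H : sgraph) (f : H -> K) : 'rV[K]_#|H| :=
  \row_i f (enum_val i).

Lemma vertex_row_adjmx (H : sgraph) (f : H -> K) :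
  vertex_row f *m adjmx K H = vertex_row (fun y => \sum_(x | adj x y) f x).
Proof.
apply/rowP => j; rewrite !mxE (reindex (@enum_rank H)) /=; last exact: onW_bij (enum_rank_bij _).
rewrite [in RHS]big_mkcond /=; apply: eq_bigr => x _.
by rewrite !mxE enum_rankK; case: adj; rewrite ?mulr1 ?mulr0.
Qed.

Lemma adj_neq (x y : G) : adj x y -> x != y.
Proof. by apply: contraTneq => ->; rewrite adj_irrefl. Qed.

Lemma sum_edges_at (a : G) (h : {set G} -> K) :
  \sum_(E : edge G | a \in val E) h (val E) = \sum_(b | adj a b) h [set a; b]%SET.
Proof.
transitivity (\sum_(S : {set G} | is_edge S && (a \in S)) h S).
  rewrite [RHS](reindex_omap (fun E : edge G => val E) insub) /=; last first.
    by move=> S /andP[SE _]; rewrite insubT.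
  by apply: eq_bigl => E; rewrite valK eqxx andbT (valP E).
(* The inverse map sends an edge at [a] to its other endpoint; the default [a] is never reached on
   such edges. *)
rewrite (reindex_onto (fun b => [set a; b]%SET) (fun S => odflt a [pick b in S :\ a]%SET)) /=.
  apply: eq_bigl => b; rewrite !inE eqxx andbT /=.
  apply/andP/idP => [[/existsP[x /existsP[y /andP[xy /eqP ab]]] /eqP bE]|ab].
    have : b != a -> adj a b.
      move=> ba; have : a \in [set x; y]%SET by rewrite -ab !inE eqxx.
      have : b \in [set x; y]%SET by rewrite -ab !inE eqxx orbT.
      rewrite !inE => /orP[]/eqP bE' /orP[]/eqP aE'.
      - by rewrite bE' aE' eqxx in ba.
      - by rewrite bE' aE' adj_sym.
      - by rewrite bE' aE'.
      - by rewrite bE' aE' eqxx in ba.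
    apply; apply: contraTneq (adj_neq xy) => ba; rewrite negbK.
    have : x \in [set a; b]%SET by rewrite ab !inE eqxx.
    have : y \in [set a; b]%SET by rewrite ab !inE eqxx orbT.
    by rewrite ba !inE !orbb => /eqP -> /eqP ->.
  split; first by apply/existsP; exists a; apply/existsP; exists b; rewrite ab eqxx.
  case: pickP => [c|/(_ b)]; last by rewrite !inE eqxx eq_sym (adj_neq ab) orbT.
  by rewrite !inE => /andP[/negbTE -> /=] /eqP ->.
move=> S /andP[/existsP[x /existsP[y /andP[xy /eqP ->]]]].
rewrite !inE => /orP[]/eqP ->.
  case: pickP => [c|/(_ y)]; last by rewrite !inE eqxx eq_sym (adj_neq xy) orbT.
  by rewrite !inE => /andP[/negbTE -> /=] /eqP ->.
case: pickP => [c|/(_ x)]; last by rewrite !inE eqxx (adj_neq xy).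
by rewrite !inE => /andP[/negbTE -> /=]; rewrite orbF => /eqP ->; rewrite finset.setUC.
Qed.

Lemma edge_endpoints (E : edge G) : exists x y, [/\ adj x y, x != y & val E = [set x; y]%SET].
Proof.
have /existsP[x /existsP[y /andP[xy /eqP EE]]] := valP E.
by exists x, y; split => //; exact: adj_neq.
Qed.

Definition edge_sum (x : G -> K) (S : {set G}) : K := \sum_(a in S) x a.

(** With [N] the incidence matrix, [N N^T = A + r], and [N^T N - 2] is the adjacency matrix of the
    line graph; hence the span of [(x, 0)] and [(0, N^T x)] is invariant. *)
Lemma Qgraph_act (x : G -> K) (lam al be : K) (r : nat) : regular G r ->
  (forall b, \sum_(a | adj a b) x a = lam * x b) ->
  forall y : Qgraph G,
  \sum_(z : Qgraph G | adj z y)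
     match z with inl a => al * x a | inr E => be * edge_sum x (val E) end =
  match y with
  | inl a => (lam + r%:R) * be * x a
  | inr E => (al + (lam + r%:R - 2) * be) * edge_sum x (val E)
  end.
Proof.
move=> Greg hx.
have at_vertex a : \sum_(E : edge G | a \in val E) edge_sum x (val E) = (lam + r%:R) * x a.
  rewrite sum_edges_at.
  transitivity (\sum_(b | adj a b) (x a + x b)).
    apply: eq_bigr => b /adj_neq ab; rewrite /edge_sum big_setU1 ?big_set1 //.
    by rewrite inE.
  rewrite big_split /= sumr_const Greg mulrDl -hx addrC mulr_natl; congr (_ + _).
  by apply: eq_bigl => b; rewrite adj_sym.
move=> [a|F]; rewrite big_sumType /=.
  rewrite big_pred0_eq add0r -mulr_sumr at_vertex; ring.
rewrite -mulr_sumr -/(edge_sum x (val F)).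
rewrite mulrDl; congr (_ + _); rewrite -mulr_sumr [_ * be]mulrC -mulrA; congr (_ * _).
(* Double counting: [E] is counted once for each vertex shared with [F], and the term [E = F]
   accounts for the 2 subtracted. *)
have -> : (lam + r%:R - 2) * edge_sum x (val F) =
    \sum_(E : edge G) #|(val E :&: val F)%SET|%:R * edge_sum x (val E) - 2 * edge_sum x (val F).
  rewrite mulrBl {1}/edge_sum mulr_sumr; congr (_ - _).
  under eq_bigr do rewrite -at_vertex.
  rewrite (exchange_big_dep xpredT) //=; apply: eq_bigr => E _.
  rewrite sumr_const mulr_natl; congr (_ *+ _); apply: eq_card => a.
  by rewrite !inE andbC.
have card_edge (E : edge G) : #|val E| = 2.
  by have [p [q [_ pq ->]]] := edge_endpoints E; rewrite cards2 pq.
rewrite [in RHS](bigD1 F) //= finset.setIid card_edge addrC addrK.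
rewrite [RHS]big_mkcond [LHS]big_mkcond /=; apply: eq_bigr => E _.
case: eqVneq => //= EF.
have le1 : (#|(val E :&: val F)%SET| <= 1)%N.
  rewrite leqNgt; apply/negP => lt1; move: EF; rewrite -(inj_eq val_inj) /=.
  have EFE : (val E :&: val F = val E)%SET.
    by apply/eqP; rewrite eqEcard finset.subsetIl card_edge.
  have EFF : (val E :&: val F = val F)%SET.
    by apply/eqP; rewrite eqEcard finset.subsetIr card_edge.
  by rewrite -EFE EFF eqxx.
rewrite -card_gt0; move: le1; case: #|_| => [|[|//]] _; rewrite ?mul0r ?mul1r //.
Qed.
End QgraphAction.

(** * Amplitudes between the original vertices of Q(G) *)

Section Amplitude.
Variable R : realType.
Implicit Types mu t : R.

(** The roots of [X ^ 2 - (mu - 2) X - mu], the characteristic polynomial of the two-dimensional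
    action; [true] selects the smaller one. *)
Definition Qroot (b : bool) mu : R :=
  (mu - 2 + (-1) ^+ b * Num.sqrt (mu ^+ 2 + 4)) / 2.

(** The weights on the two roots with total mass 1 and first moment 0, as for the vector
    [(x, 0)]. *)
Definition Qweight (b : bool) mu : R :=
  (-1) ^+ b * - Qroot (~~ b) mu / Num.sqrt (mu ^+ 2 + 4).

Lemma sqr_sqrt_disc mu : Num.sqrt (mu ^+ 2 + 4) ^+ 2 = mu ^+ 2 + 4.
Proof. by rewrite sqr_sqrtr // addr_ge0 ?sqr_ge0. Qed.

Lemma sqrt_disc_gt0 mu : 0 < Num.sqrt (mu ^+ 2 + 4).
Proof. by rewrite sqrtr_gt0 ltr_wpDl ?sqr_ge0. Qed.

Lemma Qweight_sum mu : Qweight false mu + Qweight true mu = 1.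
Proof.
rewrite /Qweight /Qroot /= expr0 expr1; have := sqrt_disc_gt0 mu.
by move: (Num.sqrt _) => s s0; field; rewrite gt_eqF.
Qed.

(** Both [|mu|] and 2 are at most [sqrt (mu ^ 2 + 4)]. The bound holds for every real [mu], whatever
    the signs of the weights. *)
Lemma Qweight_le b mu : `|Qweight b mu| <= 3 / 2.
Proof.
have s0 := sqrt_disc_gt0 mu; have s2 := sqr_sqrt_disc mu.
have s_ge2 : 2 <= Num.sqrt (mu ^+ 2 + 4).
  by rewrite -(@ler_pXn2r _ 2) ?nnegrE ?(ltW s0) // s2 expr2; have := sqr_ge0 mu; lra.
have s_gemu : `|mu| <= Num.sqrt (mu ^+ 2 + 4).
  by rewrite -(@ler_pXn2r _ 2) ?nnegrE ?(ltW s0) // s2 real_normK ?num_real // lerDl.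
rewrite /Qweight normrM normfV normrM normrX normrN1 expr1n mul1r normrN.
rewrite (gtr0_norm s0) ler_pdivrMr // /Qroot normrM (ger0_norm (_ : 0 <= 2^-1)) //.
have := ler_normD (mu - 2) ((-1) ^+ (~~ b) * Num.sqrt (mu ^+ 2 + 4)).
have := ler_normB mu 2.
rewrite normrM normrX normrN1 expr1n mul1r (gtr0_norm s0) (ger0_norm (_ : 0 <= 2)) //.
by move: `|mu - 2| `|mu| `|_ + _| s_ge2 s_gemu => a b' c; lra.
Qed.

Lemma Qweight_true0 : Qweight true 0 = 0.
Proof.
rewrite /Qweight /Qroot /= expr0 mul1r expr0n /= !add0r.
have -> : 4 = 2 ^+ 2 :> R by rewrite -natrX.
by rewrite sqrtr_sqr ger0_norm // addNr mul0r oppr0 mulr0 mul0r.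
Qed.

Lemma Qroot_false0 : Qroot false 0 = 0.
Proof.
rewrite /Qroot expr0 mul1r expr0n /= !add0r.
have -> : 4 = 2 ^+ 2 :> R by rewrite -natrX.
by rewrite sqrtr_sqr ger0_norm // addNr mul0r.
Qed.

Definition Qmoment mu (k : nat) : R :=
  Qweight false mu * Qroot false mu ^+ k + Qweight true mu * Qroot true mu ^+ k.

(** [Qmoment mu k] and [be k] are the coordinates of the [k]-th image of [(x, 0)]. The witness for
    [be k] is the divided difference of [X ^ k] at the two roots. *)
Lemma Qmoment_rec mu : exists be : nat -> R,
  [/\ Qmoment mu 0 = 1, be 0%N = 0,
   forall k, Qmoment mu k.+1 = mu * be k &
   forall k, be k.+1 = Qmoment mu k + (mu - 2) * be k].
Proof.
have s0 := sqrt_disc_gt0 mu; have s2 := sqr_sqrt_disc mu.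
pose s := Num.sqrt (mu ^+ 2 + 4).
have sE : Num.sqrt (mu ^+ 2 + 4) = s by [].
have s2' : s * s = mu ^+ 2 + 4 by rewrite -expr2.
have muE : mu = - (Qroot false mu * Qroot true mu).
  rewrite /Qroot /= expr0 expr1 sE mul1r mulN1r.
  have -> : (mu - 2 + s) / 2 * ((mu - 2 - s) / 2) = ((mu - 2) ^+ 2 - s * s) / 4 by field.
  by rewrite s2'; field.
have mu2E : mu - 2 = Qroot false mu + Qroot true mu.
  by rewrite /Qroot /= expr0 expr1; field.
exists (fun k => (Qroot false mu ^+ k - Qroot true mu ^+ k) / s); split.
- by rewrite /Qmoment !expr0 !mulr1 Qweight_sum.
- by rewrite !expr0 subrr mul0r.
- move=> k; rewrite /Qmoment /Qweight /= expr0 expr1 sE !exprS.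
  move: (Qroot false mu) (Qroot true mu) muE => x y hxy; rewrite [in RHS]hxy.
  by field; rewrite gt_eqF.
- move=> k; rewrite /Qmoment /Qweight /= expr0 expr1 sE !exprS.
  move: (Qroot false mu) (Qroot true mu) mu2E => x y ->.
  by field; rewrite gt_eqF.
Qed.

Variables (G : sgraph) (r : nat).
Hypothesis Greg : regular G r.

Lemma Qgraph_pow_eigen (x : G -> R[i]) (lam : R) :
  (forall b, \sum_(a | adj a b) x a = lam%:C%C * x b) ->
  forall k (b : G), \sum_(a : G) x a * (adjmx R[i] (Qgraph G) ^+ k)
     (enum_rank (inl a : Qgraph G)) (enum_rank (inl b : Qgraph G)) =
  (Qmoment (lam + r%:R) k)%:C%C * x b.
Proof.
move=> hx k b; have [be [m0 be0 mS beS]] := Qmoment_rec (lam + r%:R).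
pose f (al be : R[i]) (z : Qgraph G) : R[i] :=
  match z with inl a => al * x a | inr E => be * edge_sum x (val E) end.
have powE : vertex_row (f 1 0) *m adjmx R[i] (Qgraph G) ^+ k =
    vertex_row (f (Qmoment (lam + r%:R) k)%:C%C (be k)%:C%C).
  elim: k => [|k IHk]; first by rewrite expr0 mulmx1 m0 be0.
  rewrite exprSr mulmxA IHk vertex_row_adjmx; apply/rowP => i; rewrite !mxE.
  rewrite (Qgraph_act _ _ Greg hx) /f mS beS !rmorphD !rmorphM rmorphB !rmorphD !rmorph_nat /=.
  by case: (enum_val i).
have := congr1 (fun X : 'rV_ _ => X 0 (enum_rank (inl b : Qgraph G))) powE.
rewrite !mxE enum_rankK /f => <-.
rewrite (reindex (@enum_rank (Qgraph G))) /=; last exact: onW_bij (enum_rank_bij _).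
rewrite big_sumType /= [X in _ + X]big1 ?addr0 => [|E _]; last first.
  by rewrite mxE enum_rankK /= !mul0r.
by apply: eq_bigr => a _; rewrite mxE enum_rankK /= mul1r.
Qed.

Lemma Qgraph_transition (P : 'M[R[i]]_#|G|) (d : 'I_#|G| -> R) :
  (forall a b, \sum_j (P j a)^*%C * P j b = (a == b)%:R) ->
  (forall j b, \sum_a P j a * adjmx R[i] G a b = (d j)%:C%C * P j b) ->
  forall (u v : G) t,
  transition (Qgraph G) t (enum_rank (inl u : Qgraph G)) (enum_rank (inl v : Qgraph G)) =
  \sum_j (P j (enum_rank u))^*%C * P j (enum_rank v) *
    \sum_(b : bool) (Qweight b (d j + r%:R))%:C%C * expi (- (t * Qroot b (d j + r%:R))).
Proof.
move=> hP hd u v t.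
pose q (p : 'I_#|G| * bool) := (P p.1 (enum_rank u))^*%C * P p.1 (enum_rank v) *
  (Qweight p.2 (d p.1 + r%:R))%:C%C.
pose th (p : 'I_#|G| * bool) := Qroot p.2 (d p.1 + r%:R).
rewrite (@transition_exp_sum _ _ _ _ _ q th).
  rewrite -(pair_bigA _ (fun j b => q (j, b) * expi (- (t * th (j, b))))) /=.
  by apply: eq_bigr => j _; rewrite mulr_sumr; apply: eq_bigr => b _; rewrite mulrA.
move=> k; rewrite -(pair_bigA _ (fun j b => q (j, b) * (th (j, b))%:C%C ^+ k)) /=.
transitivity (\sum_j (P j (enum_rank u))^*%C * ((Qmoment (d j + r%:R) k)%:C%C * P j (enum_rank v))); last first.
  have momentC (a b x y : R) :
      (a * x ^+ k + b * y ^+ k)%:C%C = a%:C%C * x%:C%C ^+ k + b%:C%C * y%:C%C ^+ k :> R[i].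
    by rewrite rmorphD !rmorphM !rmorphXn.
  by apply: eq_bigr => j _; rewrite big_bool /q /th /= /Qmoment momentC; ring.
have hx j b : \sum_(a | adj a b) P j (enum_rank a) = (d j)%:C%C * P j (enum_rank b).
  rewrite -hd (reindex (@enum_rank G)) /=; last exact: onW_bij (enum_rank_bij _).
  rewrite [in LHS]big_mkcond /=; apply: eq_bigr => a _.
  by rewrite !mxE !enum_rankK; case: adj; rewrite ?mulr1 ?mulr0.
under eq_bigr do rewrite -(Qgraph_pow_eigen (hx _)) mulr_sumr.
rewrite exchange_big /=.
transitivity (\sum_(a : G) (u == a)%:R * (adjmx R[i] (Qgraph G) ^+ k)
   (enum_rank (inl a : Qgraph G)) (enum_rank (inl v : Qgraph G))).
  rewrite (bigD1 u) //= eqxx mul1r big1 ?addr0 // => a; rewrite eq_sym => /negbTE ->.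
  by rewrite mul0r.
apply: eq_bigr => a _; rewrite -(inj_eq enum_rank_inj) -hP mulr_suml.
by apply: eq_bigr => j _; rewrite mulrA.
Qed.

(** The [|P j u| ^ 2] have sum 1, and each of the two root weights is at most 3 / 2 in modulus,
    whence the factor 3. The root -2 at [mu = 0] has weight 0 and is exempted. *)
Lemma Qgraph_transition_near (P : 'M[R[i]]_#|G|) (d : 'I_#|G| -> R) (kap : 'I_#|G| -> R[i])
    (u v : G) t (zeta : R[i]) (e : R) :
  (forall a b, \sum_j (P j a)^*%C * P j b = (a == b)%:R) ->
  (forall j b, \sum_a P j a * adjmx R[i] G a b = (d j)%:C%C * P j b) ->
  (forall j, P j (enum_rank v) = kap j * P j (enum_rank u)) ->
  0 <= e ->
  (forall j (b : bool), P j (enum_rank u) != 0 -> (b -> d j + r%:R != 0) ->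
     `|kap j * expi (- (t * Qroot b (d j + r%:R))) - zeta| <= e%:C%C) ->
  `|transition (Qgraph G) t (enum_rank (inl u : Qgraph G)) (enum_rank (inl v : Qgraph G))
     - zeta| <= (3 * e)%:C%C.
Proof.
move=> hP hd hk e0 near; rewrite (Qgraph_transition hP hd).
have h1 : \sum_j `|P j (enum_rank u)| ^+ 2 = 1.
  have := hP (enum_rank u) (enum_rank u); rewrite eqxx => h.
  by apply: etrans h; apply: eq_bigr => j _; rewrite normCKC.
have -> : (3 * e)%:C%C = \sum_j `|P j (enum_rank u)| ^+ 2 * (3 * e)%:C%C.
  by rewrite -mulr_suml h1 mul1r.
rewrite -[X in _ - X](mul1r zeta) -h1 mulr_suml.
rewrite -sumrB; apply: le_trans (ler_norm_sum _ _ _) _; apply: ler_sum => j _.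
have [P0|P0] := eqVneq (P j (enum_rank u)) 0.
  by rewrite P0 conjc0 !mul0r normr0 expr0n !mul0r subrr normr0.
have -> : (P j (enum_rank u))^*%C * P j (enum_rank v) = `|P j (enum_rank u)| ^+ 2 * kap j.
  by rewrite hk normCKC mulrCA mulrC.
rewrite -mulrA -mulrBr normrM ger0_norm ?exprn_ge0 // ler_wpM2l ?exprn_ge0 //.
have normC (x : R) : `|x%:C%C| = (`|x|)%:C%C :> R[i].
  by rewrite normc_def /= expr0n addr0 sqrtr_sqr.
have bnd b : `|(Qweight b (d j + r%:R))%:C%C *
    (kap j * expi (- (t * Qroot b (d j + r%:R))) - zeta)| <= (3 / 2 * e)%:C%C.
  have [bmu|] := boolP (b && (d j + r%:R == 0)).
    case/andP: bmu => -> /eqP ->; rewrite Qweight_true0 mul0r normr0 ler0c.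
    by rewrite !mulr_ge0.
  rewrite negb_and => bmu; rewrite normrM normC rmorphM ler_pM //.
    by rewrite ler0c.
    by rewrite lecR Qweight_le.
  by apply: near => // bT; move: bmu; rewrite bT.
have -> : kap j * (\sum_(b : bool) (Qweight b (d j + r%:R))%:C%C * expi (- (t * Qroot b (d j + r%:R)))) - zeta =
  \sum_(b : bool) (Qweight b (d j + r%:R))%:C%C *
    (kap j * expi (- (t * Qroot b (d j + r%:R))) - zeta).
  rewrite !big_bool /=.
  have w1 : (Qweight false (d j + r%:R))%:C%C + (Qweight true (d j + r%:R))%:C%C = 1 :> R[i].
    by rewrite -rmorphD Qweight_sum.
  rewrite -[X in _ - X]mul1r -w1; ring.
apply: le_trans (ler_norm_sum _ _ _) _; rewrite big_bool /=.
apply: le_trans (lerD (bnd true) (bnd false)) _.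
by rewrite -rmorphD lecR; lra.
Qed.
End Amplitude.

(** * Perfect state transfer *)

Section Support.
Variable R : realType.

(* Equivalent to membership of [lam] in the eigenvalue support of [u]: the
   projection of [e_u] vanishes iff every eigenvector does at [u]. *)
Definition in_support (G : sgraph) (u : G) (lam : R) : Prop :=
  exists x : 'I_#|G| -> R[i],
    (forall b, \sum_a x a * adjmx R[i] G a b = lam%:C%C * x b) /\ x (enum_rank u) != 0.

(** The sum of [|x a + x b| ^ 2] over adjacent pairs vanishes, so [x] changes sign along every edge.
    By connectivity [x] is [x u] or [- x u] everywhere, and the sign is a 2-colouring. *)
Lemma in_support_oppr_bipartite (G : sgraph) (r : nat) (u : G) :
  regular G r -> connected_graph G -> in_support u (- r%:R) -> bipartite G.
Proof.
move=> Greg [_ Gconn] [y [hy y0]].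
pose x a := y (enum_rank a).
have hx b : \sum_(a | adj a b) x a = - (r%:R * x b).
  transitivity ((- r%:R)%:C%C * x b :> R[i]); last first.
    by rewrite rmorphN rmorph_nat mulNr.
  rewrite -hy [RHS](reindex (@enum_rank G)) /=; last exact: onW_bij (enum_rank_bij _).
  rewrite [in LHS]big_mkcond /=; apply: eq_bigr => a _.
  by rewrite !mxE !enum_rankK; case: adj; rewrite ?mulr1 ?mulr0.
pose S := \sum_a \sum_(b | adj a b) (x a + x b) * (x a)^*%C.
have S0 : S = 0.
  rewrite /S big1 // => a _; rewrite -mulr_suml big_split /= sumr_const Greg.
  have -> : \sum_(b | adj a b) x b = \sum_(b | adj b a) x b.
    by apply: eq_bigl => b; rewrite adj_sym.
  by rewrite hx mulr_natl subrr mul0r.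
have S0' : \sum_a \sum_(b | adj a b) (x a + x b) * (x b)^*%C = 0.
  apply: etrans S0; rewrite /S [RHS](exchange_big_dep xpredT) //=.
  apply: eq_bigr => a _; apply: eq_big => [b|b _]; first by rewrite adj_sym.
  by rewrite addrC.
have anti a b : adj a b -> x b = - x a.
  have /eqP : \sum_a \sum_(b | adj a b) `|x a + x b| ^+ 2 = 0.
    rewrite -[RHS]addr0 -[X in X + _]S0 -[X in _ + X]S0' -big_split; apply: eq_bigr => c _.
    rewrite -big_split /=; apply: eq_bigr => c' _.
    by rewrite normCK rmorphD mulrDr.
  rewrite psumr_eq0 => [/allP/(_ a)|c _]; last by apply: sumr_ge0 => *; rewrite exprn_ge0.
  rewrite mem_index_enum => /(_ isT) /=.
  rewrite psumr_eq0 => [/allP/(_ b)|c _]; last by rewrite exprn_ge0.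
  rewrite mem_index_enum => /(_ isT) /implyP h ab; have := h ab.
  by rewrite expf_eq0 /= normr_eq0 addrC addr_eq0 => /eqP.
have pm a : x a = x u \/ x a = - x u.
  have /connectP[p pp ->] := Gconn u a.
  elim/last_ind: p pp => [|p b IHp]; first by left.
  rewrite rcons_path last_rcons => /andP[/IHp h /anti ->].
  by case: h => ->; [right|left; rewrite opprK].
exists (fun a => x a == x u) => a b /anti ->.
have xN : - x u != x u by rewrite -subr_eq0 -opprD oppr_eq0 -mulr2n mulrn_eq0.
by have [->|->] := pm a; rewrite ?opprK eqxx ?(negbTE xN).
Qed.

(** At time 0 all eigenvectors would agree at [u] and [v]. Applied to [pi / g] this also yields
    [g != 0], since division by 0 gives 0. *)
Lemma PST_time_neq0 (G : sgraph) (r : nat) (u v : G) (t : R) :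
  regular G r -> PST u v t -> t != 0.
Proof.
move=> Greg pst; apply/eqP => t0.
have [P [d [hP _ hd]]] := adjmx_spectral R G.
have [uv _] := pst; have := hP (enum_rank u) (enum_rank v).
rewrite (inj_eq enum_rank_inj) (negbTE uv).
have PE j : P j (enum_rank v) = P j (enum_rank u).
  by rewrite (PST_eigenvector Greg pst (hd j)) t0 mul0r expi0 mul1r.
under eq_bigr do rewrite PE.
by rewrite hP eqxx => /eqP; rewrite oner_eq0.
Qed.

(** As [lam] is real, the conjugate vector is an eigenvector too; hence the phase relating the
    entries at [u] and [v] equals its conjugate and squares to 1. *)
Lemma PST_support (G : sgraph) (r g : nat) (u v : G) (lam : R) :
  regular G r -> PST u v (pi / g%:R : R) -> in_support u lam ->
  exists l : int, lam = r%:R - g%:R * l%:~R.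
Proof.
move=> Greg pst.
have := PST_time_neq0 Greg pst; rewrite mulf_eq0 invr_eq0 pnatr_eq0 negb_or => /andP[_ g0].
move=> [x [hx x0]].
set kap := expi (pi / g%:R * (r%:R - lam)).
have h1 : x (enum_rank v) = kap * x (enum_rank u) := PST_eigenvector Greg pst hx.
have h2 : (x (enum_rank v))^*%C = kap * (x (enum_rank u))^*%C.
  apply: (@PST_eigenvector _ _ r _ _ _ (fun a => (x a)^*%C)) pst _ => // b.
  have := congr1 (fun z => z^*) (hx b).
  rewrite rmorph_sum rmorphM /= => E.
  have -> : lam%:C%C * (x b)^*%C = (lam%:C%C)^* * (x b)^* :> R[i].
    by congr (_ * _); exact: esym (conjc_real _).
  by rewrite -E; apply: eq_bigr => a _; rewrite rmorphM /= !mxE conjC_nat.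
have h3 : x (enum_rank v) = kap^*%C * x (enum_rank u).
  by rewrite -[LHS]conjcK h2 rmorphM /= conjcK.
have kk : kap * kap = 1.
  by apply: (mulIf x0); rewrite -mulrA -h1 h3 mulrA -normCK norm_expi expr1n.
have [l hl] := expi_sqr1 kk; exists l.
have pi0 : pi != 0 :> R by rewrite gt_eqF ?pi_gt0.
have gR0 : g%:R != 0 :> R by rewrite pnatr_eq0.
have : (r%:R - lam) / g%:R = l%:~R by apply: (mulfI pi0); rewrite -hl; ring.
by move=> /(canRL (mulfVK gR0)) h; rewrite [g%:R * _]mulrC -h; ring.
Qed.

Lemma norm_subrXX (x y : R[i]) n : `|x| = 1 -> `|y| = 1 ->
  `|x ^+ n - y ^+ n| <= n%:R * `|x - y|.
Proof.
move=> x1 y1; rewrite subrXX normrM mulrC ler_wpM2r //.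
apply: le_trans (ler_norm_sum _ _ _) _.
under eq_bigr do rewrite normrM !normrX x1 y1 !expr1n mulr1.
by rewrite sumr_const card_ord.
Qed.
End Support.

(** * Pretty good state transfer *)

(** The square of [m + 1] differs from [m ^ 2] by an odd number, and larger squares exceed
    [m ^ 2 + 4]. This keeps [D] away from 1, whose phase cannot be steered. *)
Lemma sqr_add4_not_square (m s : nat) : (0 < m)%N -> (m ^ 2 + 4 != s ^ 2)%N.
Proof.
move=> m0; apply/eqP => E.
have ms : (m < s)%N by rewrite -ltn_sqr -E -[X in (X < _)%N]addn0 ltn_add2l.
have [k sE] : exists k, s = (m + k.+1)%N by exists (s - m.+1)%N; lia.
move: E; rewrite sE; case: k {sE} => [|k] E.
  by move: E; rewrite sqrnD exp1n; lia.
have : (m ^ 2 + 4 < (m + k.+2) ^ 2)%N.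
  rewrite sqrnD -addnA ltn_add2l.
  have : (2 ^ 2 <= k.+2 ^ 2)%N by rewrite leq_sqr.
  have : (0 < m * k.+2)%N by rewrite muln_gt0 m0.
  by move: (m * k.+2)%N (k.+2 ^ 2)%N => a b; lia.
by rewrite E ltnn.
Qed.

Lemma sqr_add1_not_dvd4 (x n : nat) : (x ^ 2 + 1 != 4 * n)%N.
Proof.
apply/eqP => E.
have := congr1 (fun y => y %% 4)%N E.
rewrite modnMr -modnDml -modnXm.
by have := ltn_pmod x (isT : 0 < 4)%N; case: (x %% 4)%N => [|[|[|[|//]]]].
Qed.

Lemma odd_absz_2D1 (z : int) : odd `|(2 * z + 1)%R|%N.
Proof. lia. Qed.

(** Dividing by 4 gives [(h p) ^ 2 + 1 = D s' ^ 2], and likewise for [p0]. The product of the two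
    left sides is a square, so by [pell_odd_ratio] [p] and [p0] agree up to odd factors; [s'] is odd
    by congruence modulo 4. *)
Lemma disc_parity (h p p0 : int) (D s s0 : nat) : h != 0 -> p != 0 -> p0 != 0 ->
  ~~ (4 %| D)%N -> odd `|p0|%N ->
  (`|(2 * h * p)%R| ^ 2 + 4 = D * s ^ 2)%N -> (`|(2 * h * p0)%R| ^ 2 + 4 = D * s0 ^ 2)%N ->
  odd `|p|%N /\ exists2 s' : nat, s = s'.*2 & odd s'.
Proof.
move=> h0 pn0 p0n0 D4 op0 E E0.
have half (q : int) (c : nat) : (`|(2 * h * q)%R| ^ 2 + 4 = D * c ^ 2)%N ->
    exists2 c' : nat, c = c'.*2 & (`|(h * q)%R| ^ 2 + 1 = D * c' ^ 2)%N.
  move=> Ec.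
  have Ec4 : (4 * (`|(h * q)%R| ^ 2 + 1) = D * c ^ 2)%N.
    by rewrite -Ec -mulrA [in RHS]abszM expnMn mulnDr.
  have ec : ~~ odd c.
    apply: contra D4 => oc; rewrite -(@Gauss_dvdl 4 D (c ^ 2)) -?Ec4 ?dvdn_mulr //.
    by rewrite coprimeXr // -[4%N]/(2 ^ 2)%N coprimeXl // coprime2n.
  exists c./2; first by rewrite -[LHS]odd_double_half (negbTE ec).
  apply/eqP; rewrite -(@eqn_pmul2l 4) // Ec4; apply/eqP.
  rewrite -{1}[c]odd_double_half (negbTE ec) add0n -mul2n expnMn mulnCA //.
have [s' sE E'] := half _ _ E; have [s0' s0E E0'] := half _ _ E0.
have hx (q : int) (c : nat) : (`|(h * q)%R| ^ 2 + 1 = D * c ^ 2)%N ->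
    (h * q) ^+ 2 + 1 = D%:Z * c%:Z ^+ 2.
  move=> Ec; have -> : (h * q) ^+ 2 = (`|(h * q)%R| ^ 2)%N%:Z.
    by rewrite -abszX gez0_abs ?sqr_ge0.
  by rewrite expr2 -!PoszM mulnn -Ec PoszD.
split; last first.
  exists s' => //; apply: contraT => es'.
  have := sqr_add1_not_dvd4 `|(h * p)%R| (D * s'./2 ^ 2); rewrite E'.
  by rewrite -{1}[s']odd_double_half (negbTE es') add0n -mul2n expnMn mulnCA eqxx.
have E'' : ((h * p) ^+ 2 + 1) * ((h * p0) ^+ 2 + 1) = (D%:Z * s'%:Z * s0'%:Z) ^+ 2.
  by rewrite (hx _ _ E') (hx _ _ E0'); ring.
have [i [j ij]] := pell_odd_ratio (mulf_neq0 h0 pn0) (mulf_neq0 h0 p0n0) E''.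
have : (2 * i + 1) * p = (2 * j + 1) * p0 by apply: (mulfI h0); rewrite mulrCA ij mulrCA.
move=> /(congr1 (fun z : int => odd `|z|%N)); rewrite !abszM !oddM op0 andbT.
by rewrite !odd_absz_2D1.
Qed.

(** * Prescribing the phases *)

Section Phases.
Variable R : realType.

(* [t = 4 pi k + t0] keeps the factor [expi (- t (m - 2) / 2)] of both roots equal
   to its value at [t0], while [k] steers the phases [expi (t sqrt D / 2)]. *)
Lemma approx_phases (J : finType) (m : J -> int) (B : nat -> R[i]) (t0 e : R) :
  (forall D, `|B D| = 1) -> 0 < e ->
  exists k : nat, forall j, m j != 0 -> exists D s : nat,
    [/\ ~~ (4 %| D)%N, (`|m j| ^ 2 + 4 = D * s ^ 2)%N &
     `|expi ((4 * pi * k%:R + t0) * (Num.sqrt ((m j)%:~R ^+ 2 + 4) / 2)) - B D ^+ s|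
       <= e%:C%C].
Proof.
move=> B1 e0.
pose N j := (`|m j| ^ 2 + 4)%N.
pose l := undup (flatten [seq primes (N j) | j <- enum J]).
have pl : all prime l.
  apply/allP => q; rewrite mem_undup => /flattenP[_ /mapP[j _ ->]].
  by rewrite mem_primes => /andP[].
have Nl j q : prime q -> (q %| N j)%N -> q \in l.
  move=> pq qN; rewrite mem_undup; apply/flattenP; exists (primes (N j)).
    by apply: map_f; rewrite mem_enum.
  by rewrite mem_primes pq qN addn_gt0 orbT.
have N0 j : (0 < N j)%N by rewrite addn_gt0 orbT.
have [D hD] := choice (fun j => sqfree_decomp pl (N0 j) (Nl j)).
have [s hs] := choice hD.
(* Raising to the power [s j] multiplies the error by at most [s j], which is below [T]. *)
pose T := (\sum_j s j).+1.
have e1 : 0 < e / T%:R by rewrite divr_gt0 // ltr0n.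
(* Compensates in advance for the contribution of [t0] to the phase of [sqrt d]. *)
pose b d := B d * expi (- (t0 * (Num.sqrt d%:R / 2))).
have b1 d : `|b d| = 1 by rewrite normrM B1 norm_expi mul1r.
have [k hk] := kronecker_sqrt pl (undup_uniq _) b1 e1.
exists k => j mj0; have [Dl NE] := hs j.
exists (D j), (s j); split => //.
  exact: (@subproducts_sqfree l 2 (D j) pl (undup_uniq _) isT Dl).
have D1 : D j != 1%N.
  apply/eqP => D1; have := @sqr_add4_not_square `|m j|%N (s j).
  by rewrite absz_gt0 mj0 => /(_ isT); rewrite -/(N j) NE D1 mul1n eqxx.
have sqrtE : Num.sqrt ((m j)%:~R ^+ 2 + 4) = Num.sqrt (D j)%:R * (s j)%:R :> R.
  have -> : (m j)%:~R ^+ 2 + 4 = (N j)%:R :> R.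
    rewrite natrD natrX; congr (_ + _).
    by rewrite natr_absz -rmorphXn /= -[RHS]rmorphXn /= real_normK ?num_real.
  by rewrite NE natrM natrX sqrtrM // sqrtr_sqr ger0_norm.
pose w := expi (2 * pi * Num.sqrt (D j)%:R * k%:R) * expi (t0 * (Num.sqrt (D j)%:R / 2)).
have -> : expi ((4 * pi * k%:R + t0) * (Num.sqrt ((m j)%:~R ^+ 2 + 4) / 2)) = w ^+ s j.
  by rewrite /w -expiD expiX sqrtE; congr (expi _); field.
have w1 : `|w| = 1 by rewrite normrM !norm_expi mul1r.
apply: le_trans (norm_subrXX _ w1 (B1 _)) _.
have bE : b (D j) * expi (t0 * (Num.sqrt (D j)%:R / 2)) = B (D j).
  by rewrite /b -mulrA -expiD addNr expi0 mulr1.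
have wB : `|w - B (D j)| <= (e / T%:R)%:C%C.
  apply: ltW; have := hk _ Dl D1; congr (_ < _).
  rewrite -[LHS]mulr1 -(norm_expi (t0 * (Num.sqrt (D j)%:R / 2))) -normrM mulrBl.
  by rewrite bE.
apply: le_trans (_ : (s j)%:R * (e / T%:R)%:C%C <= _); first by rewrite ler_wpM2l.
rewrite -(rmorph_nat (real_complex R)) -rmorphM lecR mulrCA ler_piMr ?(ltW e0) //.
rewrite ler_pdivrMr ?ltr0n // mul1r ler_nat leqW //.
by rewrite (bigD1 j) //= leq_addr.
Qed.

(** [B D] is the target for [expi (t sqrt D / 2)] and [zeta] the common value of all phases. The two
    roots carry conjugate irrational phases, so [B D ^ s] has to be real; at [mu = 0] only the root
    0 counts. *)
Lemma Qgraph_PGST_of_phases (G : sgraph) (r g : nat) (u v : G)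
    (t0 : R) (B : nat -> R[i]) (zeta : R[i]) :
  regular G r -> PST u v (pi / g%:R : R) ->
  (forall D, `|B D| = 1) -> `|zeta| = 1 ->
  let m (l : int) : int := 2 * r%:Z - g%:Z * l in
  (forall l : int, in_support u (r%:R - g%:R * l%:~R : R) -> m l = 0 ->
     expi (pi * l%:~R) = zeta) ->
  (forall (l : int) (D s : nat), m l != 0 -> ~~ (4 %| D)%N ->
     (`|m l| ^ 2 + 4 = D * s ^ 2)%N ->
     (B D ^+ s)^*%C = B D ^+ s /\
     expi (pi * l%:~R) * expi (- (t0 * (((m l)%:~R - 2) / 2))) * B D ^+ s = zeta) ->
  PGST R (inl u : Qgraph G) (inl v : Qgraph G).
Proof.
move=> Greg pst B1 zeta1 m H0 H1; split; first by have [uv _] := pst.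
move=> eps eps0.
have [P [d [hP _ hd]]] := adjmx_spectral R G.
have lex j : exists l : int, P j (enum_rank u) != 0 -> d j = r%:R - g%:R * l%:~R.
  have [P0|P0] := eqVneq (P j (enum_rank u)) 0; first by exists 0.
  have [|l hl] := PST_support Greg pst (_ : in_support u (d j)).
    by exists (P j).
  by exists l.
have [l hl] := choice lex.
have e0 : 0 < eps / 6 by rewrite divr_gt0.
have [k hk] := approx_phases (fun j => m (l j)) t0 B1 e0.
pose t := 4 * pi * k%:R + t0; exists t.
pose kap j := expi (pi / g%:R * (r%:R - d j)).
have hkap j : P j (enum_rank v) = kap j * P j (enum_rank u).
  exact: (PST_eigenvector Greg pst (hd j)).
have g0 : g%:R != 0 :> R.
  by have := PST_time_neq0 Greg pst; rewrite mulf_eq0 invr_eq0 negb_or => /andP[].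
have near j (b : bool) : P j (enum_rank u) != 0 -> (b -> d j + r%:R != 0) ->
    `|kap j * expi (- (t * Qroot b (d j + r%:R))) - zeta| <= (eps / 6)%:C%C.
  move=> P0; have dE := hl j P0.
  have muE : d j + r%:R = (m (l j))%:~R.
    by rewrite dE /m rmorphB !rmorphM /=; ring.
  have kapE : kap j = expi (pi * (l j)%:~R).
    by rewrite /kap dE; congr expi; field.
  have supp : in_support u (r%:R - g%:R * (l j)%:~R : R) by rewrite -dE; exists (P j).
  rewrite muE kapE intr_eq0; have [m0|m0] := eqVneq (m (l j)) 0.
    case: b => [/(_ isT)//|_]; rewrite (H0 _ supp m0) m0 mulr0z Qroot_false0.
    by rewrite mulr0 oppr0 expi0 mulr1 subrr normr0 ler0c ltW.
  move=> _; have [D [s [D4 NE near]]] := hk j m0.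
  have [Bconj <-] := H1 _ D s m0 D4 NE.
  set s2 := Num.sqrt _ / 2 in near.
  (* Adding [4 pi k] to [t0] changes the rational part by a multiple of 2 pi; only the square root
     part, of opposite sign for the two roots, depends on [k]. *)
  have -> : - (t * Qroot b (m (l j))%:~R) =
      - (t0 * (((m (l j))%:~R - 2) / 2)) + 2 * pi * (- (k%:Z * (m (l j) - 2)))%:~R
      + (-1) ^+ (~~ b) * (t * s2).
    rewrite /Qroot /s2 /t; move: (m (l j)) (Num.sqrt _) => M s'.
    rewrite mulrNz rmorphM rmorphB /= -[k%:Z%:~R]/(k%:R).
    by case: b {near}; rewrite /= ?expr0 ?expr1; field.
  rewrite !expiD expi_2pi mulr1 mulrA -mulrBr normrM normrM !norm_expi !mul1r.
  case: b => /=; rewrite ?expr0 ?expr1 ?mul1r // mulN1r.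
  by rewrite expiN -Bconj -raddfB norm_conjC.
have := Qgraph_transition_near Greg hP hd hkap (ltW e0) near.
set T := transition _ _ _ _ => Tz.
have : 1 <= `|T| + `|T - zeta|.
  by rewrite -zeta1 -{1}(subKr T zeta) (le_trans (ler_normB _ _)).
move=> h; apply: lt_le_trans (_ : (1 - eps / 2)%:C%C <= _).
  by rewrite ltcR; lra.
have -> : (1 - eps / 2)%:C%C = 1 - (3 * (eps / 6))%:C%C :> R[i].
  have -> : 3 * (eps / 6) = eps / 2 by field.
  by rewrite rmorphB rmorph1.
by rewrite lerBlDr (le_trans h) // lerD2l.
Qed.

Lemma expi_pi_even (l : int) : ~~ odd `|l|%N -> expi (pi * l%:~R : R) = 1.
Proof.
move=> el; have [q ->] : exists q, l = 2 * q by exists (l %/ 2)%Z; lia.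
by rewrite -(expi_2pi R q); congr expi; rewrite rmorphM /=; ring.
Qed.

Lemma expi_pi_odd (l : int) : odd `|l|%N -> expi (pi * l%:~R : R) = -1.
Proof.
move=> ol; have [q ->] : exists q, l = 2 * q + 1 by exists (l %/ 2)%Z; lia.
rewrite rmorphD mulrDr expiD mulr1 expi_pi expi_pi_even ?mul1r //.
by lia.
Qed.

End Phases.

Theorem theorem5p1 (R : realType) (G : sgraph) (r n m d : nat)
    (G_conn : connected_graph G) (G_reg : regular G r) (r_ge2 : (2 <= r)%N)
    (G_order : #|G| = n) (G_size : #|{: edge G}| = m)
    (lambda : 'I_d.+1 -> R)
    (lambda_decr : forall i j : 'I_d.+1, (i < j)%N -> lambda j < lambda i)
    (lambda_eig : forall x : R,
      eigenvalue (adjmx R G) x <-> exists i, x = lambda i)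
    (u v : G) (Delta : int) (Delta_sqf : squarefree Delta)
    (Delta_1 : Delta = 1 ->
      forall lam : R, eigensupp u lam -> lam \is a Num.int)
    (a : int) (b : R -> int)
    (supp_form : forall lam : R, eigensupp u lam ->
      lam = 2^-1 * (a%:~R + (b lam)%:~R * Num.sqrt Delta%:~R))
    (g : nat)
    (g_gcd : is_gcd (fun x : R => exists2 lam : R, eigensupp u lam &
      x = (lambda ord0 - lam) / Num.sqrt Delta%:~R) g)
    (G_PST : PST u v (pi / g%:R : R)) :
  (~ bipartite G -> PGST R (inl u : Qgraph G) (inl v : Qgraph G)) /\
  (bipartite G ->
    (exists k : int, r%:R / g%:R = (2 * k)%:~R :> R) ->
    PGST R (inl u : Qgraph G) (inl v : Qgraph G)).
Proof.
have g0 : g%:R != 0 :> R.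
  by have := PST_time_neq0 G_reg G_PST; rewrite mulf_eq0 invr_eq0 negb_or => /andP[].
split=> [nbip|_ [k rg]].
  (* With [t0 = 2 pi / g] the rational part contributes a second [pi l], so the sign depending on
     the parity of [l] cancels and [zeta] remains. *)
  pose zeta : R[i] := expi (- (2 * pi / g%:R * (r%:R - 1))).
  apply: (@Qgraph_PGST_of_phases R G r g u v (2 * pi / g%:R) (fun=> 1) zeta) => //.
  - by move=> D; rewrite normr1.
  - exact: norm_expi.
  - move=> l supp ml; case: nbip; apply: (in_support_oppr_bipartite G_reg G_conn (u := u) (R := R)).
    suff -> : - r%:R = r%:R - g%:R * l%:~R :> R by [].
    have := congr1 (fun z : int => z%:~R : R) ml.
    by rewrite rmorphB !rmorphM /=; lra.
  - move=> l D s _ _ _; rewrite expr1n; split; first exact: conjc1.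
    rewrite mulr1 -expiD /zeta -[RHS]mulr1 -(expi_2pi R l) -expiD; congr expi.
    by rewrite rmorphB !rmorphM /=; field.
have rE : r%:Z = 2 * k * g%:Z.
  apply: (@intr_inj R); rewrite [RHS]rmorphM /= -[r%:Z%:~R]/(r%:R) -[g%:Z%:~R]/(g%:R).
  by rewrite -rg divfK.
have gZ0 : g%:Z != 0 by rewrite -(intr_eq0 R).
have mE (l : int) : 2 * r%:Z - g%:Z * l = g%:Z * (4 * k - l) by rewrite rE; ring.
(* Here [mu = 0] forces [l = 4 k]. *)
have even_of_m0 (l : int) : 2 * r%:Z - g%:Z * l = 0 -> expi (pi * l%:~R : R) = 1.
  rewrite mE => /eqP; rewrite mulf_eq0 (negbTE gZ0) subr_eq0 => /eqP <-.
  by rewrite expi_pi_even // abszM oddM.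
(* For odd [g] the choice [t0 = 2 pi] turns the phase into [pi (g + 1) l] up to multiples of 2 pi,
   which is trivial. *)
have [og|eg] := boolP (odd g).
  apply: (@Qgraph_PGST_of_phases R G r g u v (2 * pi) (fun=> 1) 1) => //; try by move=> *; rewrite normr1.
  - by move=> l _; exact: even_of_m0.
  move=> l D s _ _ _; rewrite expr1n; split; first exact: conjc1.
  rewrite mulr1 -expiD -(expi_2pi R ((g./2)%:Z * l + l + 1 - r%:Z)); congr expi.
  have gE : g%:Z = 2 * (g./2)%:Z + 1 by move: (odd_double_half g); rewrite og; lia.
  rewrite {1}gE; move: (g./2)%:Z => q; rewrite !(rmorphB, rmorphD, rmorphM) /=.
  by field.
pose h : int := (g./2)%:Z.
have gh : g%:Z = 2 * h by rewrite /h; move: (odd_double_half g); rewrite (negbTE eg); lia.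
have h0 : h != 0 by apply: contra_neq gZ0 => h0; rewrite gh h0.
(* For even [g] the base time is 0, and the sign of an odd [l] must come from [B D]. It is set to
   the imaginary unit when [D] occurs with an odd [p]; by [disc_parity] every [p] for this [D] is
   then odd and [s] is twice an odd number, so [B D ^ s = -1]. *)
pose witness (D : nat) := exists p : int, odd `|p|%N /\
  exists s : nat, (`|(2 * h * p)%R| ^ 2 + 4 = D * s ^ 2)%N.
pose B (D : nat) : R[i] := if `[< witness D >] then expi (pi / 2) else 1.
apply: (@Qgraph_PGST_of_phases R G r g u v 0 B 1) => //.
- by move=> D; rewrite /B; case: ifP => _; rewrite ?norm_expi ?normr1.
- by rewrite normr1.
- by move=> l _; exact: even_of_m0.
move=> l D s; rewrite mE gh; set p := 4 * k - l => hp D4 NE.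
have p0 : p != 0 by apply: contra_neq hp => ->; rewrite mulr0.
have lp : odd `|l|%N = odd `|p|%N by rewrite /p; lia.
rewrite mul0r oppr0 expi0 mulr1.
have [wit|nwit] := pselect (witness D); last first.
  have -> : B D = 1 by rewrite /B asboolF.
  rewrite expr1n; split; first exact: conjc1.
  rewrite mulr1 expi_pi_even // lp; apply/negP => op; apply: nwit.
  by exists p; split => //; exists s.
have -> : B D = expi (pi / 2) by rewrite /B asboolT.
have [p1 [op1 [s1 NE1]]] := wit.
have p10 : p1 != 0 by apply: contraTneq op1 => ->.
have [op [s' -> os']] := disc_parity h0 p0 p10 D4 op1 NE NE1.
have -> : expi (pi / 2) ^+ s'.*2 = -1 :> R[i].
  rewrite -mul2n exprM expiX divfK // expi_pi -signr_odd os' expr1 //.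
rewrite expi_pi_odd ?lp // mulrNN mulr1; split => //.
by rewrite -(rmorphN1 (real_complex R)) conjc_real.
Qed.
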